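(* Let \(0 < \varepsilon < 1\) be fixed and let \(n\) be even. Then \(\mathrm{fc}(\mathrm{Match}^{*}_{n,\varepsilon}) = 2^{\Theta(n)}\). In particular, the formulation complexity of the matching problem with approximation factor \(1 - \varepsilon/n\) satisfies \(\mathrm{fc}(\mathrm{Match}_{n}, 1 - \varepsilon/n) = 2^{\Theta(n)}\). Consequently, the family of matching problems \(\{\mathrm{Match}_n\}_n\) does not admit a fully polynomial-size linear programming relaxation scheme (FPSRS).
   Context: A maximization problem \(P=(\mathcal S,\mathcal F)\) consists of a set \(\mathcal S\) of feasible solutions and a set \(\mathcal F\) of real-valued objective functions on \(\mathcal S\). An approximation problem \(P^*\) is such a \(P\) together with numbers \(f^*\ge \max f\) for each \(f\in\mathcal F\) (approximation guarantees). An LP formulation of \(P^*\) consists of a system \(Ax\le b\) in variables \(x\in\mathbb R^d\), a point \(x^s\) with \(Ax^s\le b\) for each \(s\in\mathcal S\), and an affine map \(w^f:\mathbb R^d\to\mathbb R\) for each \(f\in\mathcal F\) with \(w^f(x^s)=f(s)\) for all \(s\), such that \(\max\{w^f(x): Ax\le b\}\le f^*\) for all \(f\). Its size is the number of inequalities; the formulation complexity \(\mathrm{fc}(P^* )\) is the minimum size of an LP formulation. For an approximation factor \(0<\rho\le 1\), \(\mathrm{fc}(P,\rho)\) denotes \(\mathrm{fc}\) of the approximation problem with \(f^*=\max f/\rho\). The matching problem \(\mathrm{Match}_n\): feasible solutions are all matchings \(M\) of the complete graph \(K_n\) on \([n]\); objective functions are \(f_G(M)=|M\cap E(G)|\) for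 all graphs \(G\) with \(V(G)\subseteq[n]\). The approximation problem \(\mathrm{Match}^*_{n,\varepsilon}\) (for \(n\) even, \(0<\varepsilon\le 1\)) has as feasible solutions the perfect matchings \(M\) of \(K_n\), as objective functions \(f_U(M)=|E[U]\cap M|\) for all odd-size subsets \(U\subseteq[n]\) (where \(E[U]\) is the set of edges of \(K_n\) with both endpoints in \(U\)), and approximation guarantees \(f_U^*=(|U|-1+\varepsilon)/2\). A family \(\{P_n\}\) of maximization problems admits an FPSRS if there is a polynomial \(p\) such that for every \(\varepsilon>0\) and every \(n\), \(\mathrm{fc}(P_n,1-\varepsilon)\le p(n,1/\varepsilon)\). The \(\Theta\) constants may depend on \(\varepsilon\). *)

(* Defs.v *)
From HB Require Import structures.
From mathcomp Require Import all_boot all_order all_algebra.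
From mathcomp Require Import all_classical all_reals all_analysis.

Set Implicit Arguments.
Unset Strict Implicit.
Unset Printing Implicit Defensive.

Import Order.TTheory GRing.Theory Num.Theory.
Local Open Scope ring_scope.

(* The set of objective functions is given as a family [objv] indexed by a
   type [obj]; two indices may denote the same function. *)
Record max_problem (R : realType) := MaxProblem {
  sol : Type;
  obj : Type;
  objv : obj -> sol -> R }.

Record approx_problem (R : realType) := ApproxProblem {
  base :> max_problem R;
  guarantee : obj base -> R }.

(* [f* >= max f] for every objective [f].  This is a predicate rather than a
   field of [approx_problem]: every LP formulation enforces it (see
   [lp_formulation_guarantees_valid]).  The two problems studied here
   satisfy it (see [MatchStar_guarantees_valid] and
   [Match_guarantees_valid]). *)
Definition guarantees_valid (R : realType) (P : approx_problem R) : Prop :=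
  forall (f : obj P) (s : sol P), objv f s <= guarantee f.

(* The system is [A x <= b], the point of [s] is [pt s], and the affine map of
   [f] is [x |-> w f *m x + c f]. *)
Record lp_formulation (R : realType) (P : approx_problem R) (m : nat) :=
  LPFormulation {
    lp_dim : nat;
    lp_mx : 'M[R]_(m, lp_dim);
    lp_rhs : 'cV[R]_m;
    lp_feasible := fun x : 'cV[R]_lp_dim =>
      forall i : 'I_m, (lp_mx *m x) i 0 <= lp_rhs i 0;
    lp_pt : sol P -> 'cV[R]_lp_dim;
    lp_w : obj P -> 'rV[R]_lp_dim;
    lp_c : obj P -> R;
    lp_obj := fun (f : obj P) (x : 'cV[R]_lp_dim) => (lp_w f *m x) 0 0 + lp_c f;
    lp_pt_feasible : forall s, lp_feasible (lp_pt s);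
    lp_obj_exact : forall f s, lp_obj f (lp_pt s) = objv f s;
    lp_obj_le : forall f x, lp_feasible x -> lp_obj f x <= guarantee f }.

Lemma lp_formulation_guarantees_valid (R : realType) (P : approx_problem R)
  (m : nat) : lp_formulation P m -> guarantees_valid P.
Proof.
move=> L f s; rewrite -(lp_obj_exact L); apply: (lp_obj_le (l := L)).
exact: lp_pt_feasible.
Qed.

(* The infimum of a nonempty set of natural numbers is its minimum (see
   [fc_min]); [fc P = +oo] exactly when [P] has no LP formulation. *)
Definition fc (R : realType) (P : approx_problem R) : \bar R :=
  ereal_inf [set (m%:R)%:E | m in [set m | inhabited (lp_formulation P m)]]%classic.

Lemma fc_min (R : realType) (P : approx_problem R) (m : nat) :
  inhabited (lp_formulation P m) ->
  (forall k, inhabited (lp_formulation P k) -> (m <= k)%N) ->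
  fc P = (m%:R)%:E.
Proof.
move=> Pm minm; apply/eqP; rewrite eq_le; apply/andP; split.
  by apply: ereal_inf_lbound; exists m.
by apply: le_ereal_inf_tmp => _ [k Pk <-]; rewrite lee_fin ler_nat minm.
Qed.

(* The supremum is a maximum for the finite, nonempty solution sets below.
   Meant for [0 < rho <= 1]. *)
Definition with_factor (R : realType) (P : max_problem R) (rho : R) :
    approx_problem R :=
  @ApproxProblem R P (fun f => sup (range (objv f)) / rho).

Definition fc_factor (R : realType) (P : max_problem R) (rho : R) : \bar R :=
  fc (with_factor P rho).

Definition edges_in (n : nat) (U : {set 'I_n}) : {set {set 'I_n}} :=
  [set e : {set 'I_n} | (e \subset U) && (#|e| == 2)].

Definition is_matching (n : nat) (M : {set {set 'I_n}}) : bool :=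
  (M \subset edges_in [set: 'I_n]) && finset.trivIset M.

Definition is_perfect_matching (n : nat) (M : {set {set 'I_n}}) : bool :=
  is_matching M && (finset.cover M == [set: 'I_n]).

Definition matching (n : nat) := {M : {set {set 'I_n}} | is_matching M}.

Definition perfect_matching (n : nat) :=
  {M : {set {set 'I_n}} | is_perfect_matching M}.

Record graph_within (n : nat) := GraphWithin {
  gverts : {set 'I_n};
  gedges : {set {set 'I_n}};
  gedges_sub : gedges \subset edges_in gverts }.

Definition odd_subset (n : nat) := {U : {set 'I_n} | odd #|U|}.

Definition Match (R : realType) (n : nat) : max_problem R :=
  @MaxProblem R (matching n) (graph_within n)
    (fun G M => #|val M :&: gedges G|%:R).

Definition MatchStar (R : realType) (n : nat) (eps : R) : approx_problem R :=
  @ApproxProblem R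
    (@MaxProblem R (perfect_matching n) (odd_subset n)
       (fun U M => #|edges_in (val U) :&: val M|%:R))
    (fun U => (#|val U|%:R - 1 + eps) / 2).

(* [u n = 2^Theta(n)] as [n] tends to infinity within [D]. *)
Definition eq_two_pow_Theta (R : realType) (D : set nat) (u : nat -> \bar R) :
    Prop :=
  exists c C : R, [/\ 0 < c, 0 < C &
    \forall n \near \oo%classic, D n ->
      ((2 `^ (c * n%:R))%:E <= u n)%E /\ (u n <= (2 `^ (C * n%:R))%:E)%E].

(* A polynomial in two variables is taken in [{poly {poly R}}]: the outer
   variable is evaluated at [n] and the inner one at [1 / eps].  Since
   approximation factors are positive, [eps] ranges over [0 < eps < 1]. *)
Definition admits_FPSRS (R : realType) (P : nat -> max_problem R) : Prop :=
  exists p : {poly {poly R}}, forall (eps : R) (n : nat), 0 < eps < 1 ->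
    (fc_factor (P n) (1 - eps) <= (p.[(n%:R)%:P].[eps^-1])%:E)%E.

(* Validity of the guarantees. *)

Lemma card_matching_edges_in (n : nat) (M : {set {set 'I_n}})
    (U : {set 'I_n}) :
  is_matching M -> (#|edges_in U :&: M| * 2 <= #|U|)%N.
Proof.
move=> /andP[/fintype.subsetP ME tM].
have tUM : finset.trivIset (edges_in U :&: M).
  apply/finset.trivIsetP => A B /setIP[_ AM] /setIP[_ BM].
  by move/finset.trivIsetP : tM; apply.
have -> : (#|edges_in U :&: M| * 2)%N = #|finset.cover (edges_in U :&: M)|.
  rewrite -(eqP tUM) -sum_nat_const; apply: eq_bigr => e.
  by rewrite !inE => /andP[/andP[_ /eqP]].
apply: subset_leq_card; apply/finset.bigcupsP => e.
by rewrite !inE => /andP[/andP[]].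
Qed.

Lemma MatchStar_guarantees_valid (R : realType) (n : nat) (eps : R) :
  0 <= eps -> guarantees_valid (MatchStar n eps).
Proof.
move=> eps0 [U oU] [M /= /andP[mM _]] /=.
have := card_matching_edges_in U mM.
rewrite leq_eqVlt => /orP[/eqP h|h].
  by move: oU; rewrite -h oddM andbF.
rewrite ler_pdivlMr // (@le_trans _ _ (#|U|%:R - 1)) ?lerDl //.
by rewrite lerBrDr -natrM -[1]/(1%:R) -natrD ler_nat addn1.
Qed.

Lemma Match_guarantees_valid (R : realType) (n : nat) (rho : R) :
  0 < rho <= 1 -> guarantees_valid (with_factor (Match R n) rho).
Proof.
move=> /andP[rho0 rho1] G M /=.
set f := (fun M : matching n => _ : R); rewrite -/(f M).
have ubf : has_ubound (range f).
  exists (#|gedges G|%:R) => _ [N _ <-]; rewrite /f /= ler_nat.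
  exact/subset_leq_card/finset.subsetIr.
have leM : f M <= sup (range f) by apply: ub_le_sup => //; exists M.
apply: (le_trans leM); rewrite ler_pdivlMr // ler_piMr //.
by apply: le_trans leM; rewrite /f ler0n.
Qed.

(* Main.v *)
Require Import Defs.
From mathcomp Require Import all_boot all_order all_algebra all_fingroup.
From mathcomp Require Import all_classical all_reals all_analysis.
From mathcomp Require Import zify ring lra.
(* Again, so that set names refer to finite sets and not to classical ones. *)
From mathcomp Require Import fintype finset.

Set Implicit Arguments.
Unset Strict Implicit.
Unset Printing Implicit Defensive.

Import Order.TTheory GRing.Theory Num.Theory.
Local Open Scope ring_scope.

(* Lower bound.  By Farkas' lemma an LP formulation with r inequalities writes
   the slack matrix, whose entries are (l - 1 + eps) / 2 when l edges of M leave
   U, as a sum of r + 1 nonnegative products u(U) v(M).  As in Rothvoss's proof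
   for the matching polytope, let T_l(u, v) be the average of u(U) v(M) over
   random (U, M) with l crossing edges, where U is completely random outside of a
   bounded part of the graph.  If 0 <= u, v <= 1 then
     T_3 <= (3 + small) T_1 + O(1 / k^2) T_k + exp(- c n).
   Applied to every term of the factorization this bounds (2 + eps) / 2 by
   (3 + small) eps / 2 + O(1 / k) + r n exp(- c n), and eps < 1 makes r
   exponential.
   The inequality comes from a random embedding of a gadget of bounded size.
   Changing U by the two ends of an edge of M, or exchanging two edges of M that
   avoid U, hardly changes the averages of u and v: the changed bit looks like
   any other of linearly many random bits, and Chernoff's bound controls the
   average bias of these bits.  So locally the averages behave as if they were
   invariant under all changes that preserve the crossing edges, which makes the
   set of good triples of crossing edges closed enough: either it contains no
   two triples with exactly one common edge, and then there are at most k of them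
   by the oddtown theorem, or each good triple contains a good edge.

   Upper bound.  A matching is a path in the graph of vertex sets, so LP duality
   for longest paths gives a factorization of the slack matrix with 4^n terms,
   one for each possible arc. *)

(** * Farkas' lemma *)

Lemma widen_ord_lift_max (m : nat) (i : 'I_m) :
  widen_ord (leqnSn m) i = lift ord_max i.
Proof. by apply: val_inj; rewrite /= /bump leqNgt ltn_ord. Qed.

(* Bartl's induction: if dropping the last inequality breaks the implication,
   a witness [x0] of this is used to eliminate that inequality from the others. *)
Lemma farkas (F : realFieldType) (d m : nat) (a : 'I_m -> 'rV[F]_d)
    (c : 'rV[F]_d) :
  (forall x : 'cV[F]_d, (forall i, (a i *m x) 0 0 <= 0) -> (c *m x) 0 0 <= 0) ->
  exists l : 'I_m -> F, (forall i, 0 <= l i) /\ c = \sum_i l i *: a i.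
Proof.
elim: m a c => [|m IH] a c ac.
  exists (fun=> 0); split=> //; rewrite big_ord0; apply/rowP => j.
  have c0 (x : 'cV[F]_d) : (c *m x) 0 0 <= 0 by apply: ac => -[].
  have cE s : (c *m (s *: delta_mx j 0 : 'cV[F]_d)) 0 0 = s * c 0 j.
    by rewrite -scalemxAr -colE !mxE.
  have := c0 (1 *: delta_mx j 0); have := c0 ((-1) *: delta_mx j 0).
  rewrite !cE !mxE; lra.
have wl := @widen_ord_lift_max m.
set a' := fun i : 'I_m => a (widen_ord (leqnSn m) i).
set z := a ord_max.
have [h|] := EM (forall x : 'cV[F]_d, (forall i, (a' i *m x) 0 0 <= 0) ->
    (c *m x) 0 0 <= 0).
  have [l [l0 ->]] := IH a' c h.
  exists (fun i => if unlift ord_max i is Some j then l j else 0); split.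
    by move=> i; case: unliftP.
  rewrite big_ord_recr /= unlift_none scale0r addr0; apply: eq_bigr => i _.
  by rewrite /a' wl liftK.
move=> /existsNP[x0 /not_implyP[ax0 /negP]]; rewrite -ltNge => cx0.
have zx0 : 0 < (z *m x0) 0 0.
  rewrite ltNge; apply/negP => zx0; move: cx0; rewrite ltNge => /negP; apply.
  apply: ac => i; case: (unliftP ord_max i) => [j ->|-> //].
  rewrite -wl; exact: ax0.
set q := (z *m x0) 0 0 in zx0.
pose r (v : 'rV[F]_d) : F := (v *m x0) 0 0 / q.
have [|l [l0 cE]] := IH (fun i => a' i - r (a' i) *: z) (c - r c *: z).
  move=> x hx.
  (* [y] is the projection of [x] along [x0] onto the hyperplane where the last inequality is
     tight. *)
  pose y := x - ((z *m x) 0 0 / q) *: x0.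
  have yE (v : 'rV[F]_d) : (v *m y) 0 0 = ((v - r v *: z) *m x) 0 0.
    have sc t (e : 'M[F]_1) : (t *: e) 0 0 = t * e 0 0 by rewrite mxE.
    have sb (e e' : 'M[F]_1) : (e - e') 0 0 = e 0 0 - e' 0 0 by rewrite !mxE.
    by rewrite /y mulmxBr mulmxBl -scalemxAr -scalemxAl !(sb, sc) /r; ring.
  rewrite -yE; apply: ac => i; case: (unliftP ord_max i) => [j ->|->].
    by rewrite -wl yE; apply: hx.
  by rewrite yE /r -/z -/q divff ?gt_eqF // scale1r subrr mul0mx mxE.
(* Nonnegative because [r c > 0] while every [r (a' i)] is at most 0. *)
pose lz := r c - \sum_i l i * r (a' i).
exists (fun i => if unlift ord_max i is Some j then l j else lz); split.
  move=> i; case: unliftP => // _; rewrite subr_ge0.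
  apply: (@le_trans _ _ 0); last by rewrite divr_ge0 // ltW.
  apply: sumr_le0 => j _; rewrite mulr_ge0_le0 // /r.
  by rewrite mulr_le0_ge0 // invr_ge0 ltW.
rewrite big_ord_recr /= unlift_none.
have -> : c = \sum_i l i *: (a' i - r (a' i) *: z) + r c *: z.
  by rewrite -cE subrK.
rewrite -/z /lz scalerBl scaler_suml [r c *: z - _]addrC addrA; congr (_ + _).
rewrite -sumrB; apply: eq_bigr => i _.
by rewrite wl liftK -wl scalerBr scalerA.
Qed.

(* Homogenization, with one more coordinate [t] and the inequality [t >= 0]. *)
Lemma affine_farkas (F : realFieldType) (d m : nat) (A : 'M[F]_(m, d))
    (b : 'cV[F]_m) (w : 'rV[F]_d) (g : F) :
  (exists x : 'cV[F]_d, forall i, (A *m x) i 0 <= b i 0) ->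
  (forall x : 'cV[F]_d, (forall i, (A *m x) i 0 <= b i 0) ->
     (w *m x) 0 0 <= g) ->
  exists (l : 'I_m -> F) (l0 : F), [/\ forall i, 0 <= l i, 0 <= l0 &
    forall x : 'cV[F]_d,
      g - (w *m x) 0 0 = l0 + \sum_i l i * (b i 0 - (A *m x) i 0)].
Proof.
move=> [x0 Ax0] Aw.
pose a (i : 'I_(m + 1)) : 'rV[F]_(d + 1) :=
  match fintype.split i with
  | inl j => row_mx (row j A) (- b j 0)%:M
  | inr _ => row_mx 0 (-1)%:M end.
have al j : a (lshift 1 j) = row_mx (row j A) (- b j 0)%:M.
  by rewrite /a (unsplitK (inl j)).
have ar : a (rshift m 0) = row_mx 0 (-1)%:M by rewrite /a (unsplitK (inr 0)).
have aE (u : 'rV[F]_d) s (x : 'cV[F]_(d + 1)) :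
    (row_mx u s%:M *m x) 0 0 = (u *m usubmx x) 0 0 + s * dsubmx x 0 0.
  by rewrite -[x in LHS]vsubmxK mul_row_col mxE mul_scalar_mx [in X in _ + X]mxE.
have rE j (x : 'cV[F]_d) : (row j A *m x) 0 0 = (A *m x) j 0.
  by rewrite -row_mul mxE.
have [|l [l0 cE]] := @farkas F (d + 1) (m + 1) a (row_mx w (- g)%:M).
  move=> x hx; rewrite aE; set y := usubmx x; set t := dsubmx x 0 0.
  have Ay j : (A *m y) j 0 <= t * b j 0.
    have := hx (lshift 1 j); rewrite al aE rE -/y -/t; lra.
  have t0 : 0 <= t.
    have := hx (rshift m 0); rewrite ar aE mul0mx mxE -/t; lra.
  have [t_eq0|tn0] := eqVneq t 0.
    rewrite t_eq0 mulr0 addr0 leNgt; apply/negP => wy.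
    (* At [t = 0], [y] is a recession direction; if [w] increased along it, the feasible point
       [x0 + s *: y] would have value [g + 1]. *)
    pose s := (g - (w *m x0) 0 0 + 1) / (w *m y) 0 0.
    have gx0 := Aw _ Ax0.
    have s0 : 0 <= s by rewrite divr_ge0 ?ltW //; lra.
    have := Aw (x0 + s *: y); rewrite !mulmxDr -!scalemxAr.
    have -> : (w *m x0 + s *: (w *m y)) 0 0 = g + 1.
      by rewrite mxE [in X in _ + X]mxE /s divfK ?gt_eqF //; ring.
    suff h : forall i, (A *m x0 + s *: (A *m y)) i 0 <= b i 0.
      by move=> /(_ h); lra.
    move=> i; rewrite mxE [in X in _ + X]mxE.
    have := Ay i; rewrite t_eq0 mul0r => Ayi.
    have := mulr_ge0_le0 s0 Ayi; have := Ax0 i; lra.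
  have tp : 0 < t by rewrite lt_neqAle eq_sym tn0.
  have := Aw (t^-1 *: y); rewrite -!scalemxAr.
  suff h : forall i, (t^-1 *: (A *m y)) i 0 <= b i 0.
    move=> /(_ h); rewrite mxE mulrC ler_pdivrMr //; lra.
  by move=> i; rewrite mxE mulrC ler_pdivrMr // mulrC.
exists (fun i => l (lshift 1 i)), (l (rshift m 0)); split=> // x.
pose z : 'cV[F]_(d + 1) := col_mx x 1%:M.
have zE u s : (row_mx u s%:M *m z) 0 0 = (u *m x) 0 0 + s.
  by rewrite aE col_mxKu col_mxKd [X in _ * X]mxE eqxx mulr1.
have dE (e e' : 'M[F]_1) : (e + e') 0 0 = e 0 0 + e' 0 0 by rewrite mxE.
have sE k (e : 'M[F]_1) : (k *: e) 0 0 = k * e 0 0 by rewrite mxE.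
have := congr1 (fun v => (v *m z) 0 0) cE.
rewrite /= zE big_split_ord /= big_ord1 mulmxDl mulmx_suml dE summxE.
rewrite -scalemxAl sE ar zE mul0mx [X in _ * (X + _)]mxE add0r.
have -> : \sum_i (l (lshift 1 i) *: a (lshift 1 i) *m z) 0 0 =
          - \sum_i l (lshift 1 i) * (b i 0 - (A *m x) i 0).
  rewrite -sumrN; apply: eq_bigr => i _.
  by rewrite -scalemxAl sE al zE rE; ring.
lra.
Qed.

(** * Families of triples *)

(** The incidence matrix [A] over ['F_2] satisfies [A *m A^T = 1%:M], so it has at least as many
    columns as rows. *)
Lemma oddtown (K : finType) (T : {set {set K}}) :
  (forall h, h \in T -> odd #|h|) ->
  (forall h h', h \in T -> h' \in T -> h != h' -> ~~ odd #|h :&: h'|) ->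
  (#|T| <= #|K|)%N.
Proof.
move=> oT eT.
pose A : 'M['F_2]_(#|T|, #|K|) :=
  \matrix_(i, j) (enum_val j \in (enum_val i : {set K}))%:R.
suff AA : A *m A^T = 1%:M by apply: mulmx1_min AA.
apply/matrixP => i j; rewrite !mxE.
have natF2 n : n%:R = (odd n)%:R :> 'F_2.
  by rewrite -modn2 -(Fp_nat_mod (isT : prime 2)).
have -> : \sum_l A i l * A^T l j = #|enum_val i :&: enum_val j|%:R.
  rewrite -[in RHS]sum1_card natr_sum [RHS]big_mkcond /=.
  rewrite [RHS](reindex (enum_val : 'I_#|K| -> K)) /=; last first.
    by apply: onW_bij; apply: enum_val_bij.
  apply: eq_bigr => l _; rewrite !mxE inE.
  by case: (_ \in _); case: (_ \in _); rewrite ?mul0r ?mulr0 ?mulr1.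
rewrite natF2; have [->|ij] := eqVneq i j.
  by rewrite setIid oT ?enum_valP.
by rewrite (negbTE (eT _ _ _ _ _)) ?enum_valP // (inj_eq enum_val_inj).
Qed.

Lemma card_draws_mem (K : finType) (i : K) (r : nat) :
  (#|[set h : {set K} | (i \in h) && (#|h| == r.+1)]| <= 'C(#|K|.-1, r))%N.
Proof.
have <- : #|[set~ i]| = #|K|.-1 by rewrite cardsC1.
rewrite -cards_draws -(@card_in_imset _ _ (fun h : {set K} => h :\ i)).
  apply: subset_leq_card; apply/subsetP => _ /imsetP[h + ->].
  rewrite !inE => /andP[ih /eqP ch]; apply/andP; split.
    by rewrite subsetC setDE setCI setCK subsetU // subxx orbT.
  by have := cardsD1 i h; rewrite ih ch => -[->].
move=> h h'; rewrite !inE => /andP[ih _] /andP[ih' _] hh'.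
by rewrite -(setD1K ih) hh' setD1K.
Qed.

(** If no singleton is good, two good triples never share exactly one element, so distinct ones meet
    evenly and [oddtown] applies. Otherwise every good triple contains a good singleton, and the
    triples through each good singleton are counted. *)
Lemma card_good_triples (K : finType) (good : pred {set K}) :
  (5 <= #|K|)%N ->
  (forall e (h h' : {set K}), #|h| = 3%N -> #|h'| = 1%N \/ #|h'| = 3%N ->
     h :&: h' = [set e] -> good h -> good h' -> good [set e]) ->
  (forall e (h : {set K}), #|h| = 3%N -> e \in h -> good [set e] -> good h) ->
  (#|[set h : {set K} | good h && (#|h| == 3%N)]| <=
   #|K| + #|[set e : K | good [set e]]| * 'C(#|K|.-1, 2))%N.
Proof.
move=> K5 meet up.
have [g0|[e0]] := set_0Vmem [set e : K | good [set e]].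
  rewrite g0 cards0 addn0; apply: oddtown => [h|h h'].
    by rewrite inE => /andP[_ /eqP ->].
  rewrite !inE => /andP[gh /eqP h3] /andP[gh' /eqP h'3] hh'.
  apply/negP => o; suff /cards1P[e he] : #|h :&: h'| == 1%N.
    suff : e \in [set e : K | good [set e]] by rewrite g0 inE.
    by rewrite inE; apply: meet he gh gh' => //; right.
  have : (#|h :&: h'| < 3)%N.
    rewrite ltn_neqAle -{2}h3 subset_leq_card ?subsetIl // andbT.
    apply/eqP => c3; move/eqP: hh'; apply; apply/eqP.
    have hI : h :&: h' = h.
      by apply/eqP; rewrite eqEcard subsetIl c3 h3.
    have h'I : h :&: h' = h'.
      by apply/eqP; rewrite eqEcard subsetIr c3 h'3.
    by apply/eqP; rewrite -{1}hI h'I.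
  by case: #|_| o => [|[|[|]]].
rewrite inE => ge0; apply: (leq_trans _ (leq_addl _ _)).
apply: (@leq_trans #|\bigcup_(e in [set e : K | good [set e]])
    [set h : {set K} | (e \in h) && (#|h| == 3%N)]|); last first.
  rewrite -sum_nat_const.
  apply: (@big_ind2 _ _ (fun (B : {set {set K}}) r => #|B| <= r)%N) => [|B r C s|e _].
  - by rewrite cards0.
  - by move=> Br Cs; apply: leq_trans (leq_card_setU _ _) (leq_add Br Cs).
  - exact: card_draws_mem.
apply: subset_leq_card; apply/subsetP => h; rewrite inE => /andP[gh h3].
suff [e eh ge] : exists2 e, e \in h & good [set e].
  by apply/bigcupP; exists e; rewrite ?inE ?eh.
have [e0h|e0h] := boolP (e0 \in h); first by exists e0.
have /card_gt0P[i ih] : (0 < #|h|)%N by rewrite (eqP h3).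
(* The size of [K] leaves room for [z] outside [e0 |: h]; then [[set e0; i; z]] is a good triple
   that meets [h] in [i] alone. *)
have /card_gt0P[z] : (0 < #|~: (e0 |: h)|)%N.
  by rewrite cardsCs setCK cardsU1 e0h (eqP h3) subn_gt0.
rewrite !inE negb_or => /andP[ze0 zh].
exists i => //; have ie0 : i != e0 by apply: contraNneq e0h => <-.
have iz : i != z by apply: contraNneq zh => <-.
have h'3 : #|[set e0; i; z]| = 3%N.
  by rewrite setUC cardsU1 cards2 !inE negb_or ze0 eq_sym iz eq_sym ie0.
apply: (meet i h [set e0; i; z]) => //; try by right.
- exact/eqP.
- apply/setP => x; rewrite !inE; have [->|xi] := eqVneq x i.
    by rewrite ih orbT.
  have [->|xe0] := eqVneq x e0; first by rewrite (negbTE e0h).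
  by have [->|xz] := eqVneq x z; rewrite ?(negbTE zh) ?andbF.
- by apply: (up e0) => //; rewrite !inE eqxx.
Qed.

(** * Involutions and flips *)

Definition fixset (K : finType) (p : {perm K}) : {set K} := [set i | p i == i].

(** A flip either adds the 2-cycle of [i] to [a] or splits it into two fixed points of [p]. Both
    preserve [a :&: fixset p], the index set of the crossing edges. *)
Definition flippable (K : finType) (p : {perm K}) (a : {set K}) (i : K) : bool :=
  [&& [forall x, p (p x) == x], [forall x in a, p x \in a], p i != i,
      i \notin a & (#|a :&: fixset p| == 1%N) || (#|a :&: fixset p| == 3%N)].

Lemma flippableN (K : finType) (p : {perm K}) (a : {set K}) (i : K) :
  flippable p a i -> p i \notin a.
Proof.
case/and5P => /forallP pp /forall_inP ap _ + _; apply: contra => /ap.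
by rewrite (eqP (pp i)).
Qed.

Lemma tperm_split (K : finType) (p : {perm K}) (i : K) :
  (forall x, p (p x) = x) -> let q := (p * tperm i (p i))%g in
  (forall x, q (q x) = x) /\ fixset q = i |: (p i |: fixset p).
Proof.
move=> pp q.
have qE x : q x = if (x == i) || (x == p i) then x else p x.
  rewrite permM; have [->|xi] := eqVneq x i; first by rewrite tpermR.
  have [->|xpi] := eqVneq x (p i); first by rewrite pp tpermL.
  rewrite tpermD //; last by rewrite (inj_eq perm_inj) eq_sym.
  by apply: contraNneq xpi => ->; rewrite pp.
split=> [x|].
  rewrite (qE x); case: ifP => [h|/norP[xi xpi]]; first by rewrite qE h.
  by rewrite qE (inj_eq perm_inj) (can2_eq pp pp) (negbTE xi) (negbTE xpi) pp.
apply/setP => x; rewrite !inE qE.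
by case: (x == i) => //=; case: (x == p i) => //=; rewrite eqxx.
Qed.

Lemma tperm_join (K : finType) (p : {perm K}) (x y : K) :
  (forall z, p (p z) = z) -> x != y -> x \in fixset p -> y \in fixset p ->
  let q := (p * tperm x y)%g in
  [/\ forall z, q (q z) = z, fixset q = fixset p :\ x :\ y & q x = y].
Proof.
move=> pp xy; rewrite !inE => /eqP px /eqP py q.
have qx : q x = y by rewrite permM px tpermL.
have qy : q y = x by rewrite permM py tpermR.
have qE z : z != x -> z != y -> q z = p z.
  move=> zx zy; rewrite permM tpermD //.
    by rewrite -{1}px (inj_eq perm_inj) eq_sym.
  by rewrite -{1}py (inj_eq perm_inj) eq_sym.
split=> // [z|].
  have [->|zx] := eqVneq z x; first by rewrite qx qy.
  have [->|zy] := eqVneq z y; first by rewrite qy qx.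
  rewrite (qE z) // qE //.
    by rewrite -{1}px (inj_eq perm_inj).
  by rewrite -{1}py (inj_eq perm_inj).
apply/setP => z; rewrite !inE.
have [->|zy] := eqVneq z y; first by rewrite qy (negbTE xy).
have [->|zx] := eqVneq z x; first by rewrite qx eq_sym (negbTE xy).
by rewrite qE.
Qed.

(** By induction on the complement of [h]: two of its elements are first treated as fixed and then
    joined by [tperm_join]. *)
Lemma exists_involution (K : finType) (h : {set K}) : ~~ odd #|~: h| ->
  exists2 p : {perm K}, (forall x, p (p x) = x) & fixset p = h.
Proof.
have [m] := ubnP #|~: h|; elim: m h => // m IH h hm oh.
have [h0|[x xh]] := set_0Vmem (~: h).
  exists 1%g => [x|]; first by rewrite !perm1.
  rewrite -[h]setCK h0; apply/setP => x; by rewrite !inE perm1 eqxx.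
have := cardsD1 x (~: h); rewrite xh => c1.
have [h1|[y]] := set_0Vmem (~: h :\ x).
  by move: oh; rewrite c1 h1 cards0.
rewrite 2!inE => /andP[yx yh].
have := cardsD1 y (~: h :\ x); rewrite 2!inE yx yh => c2.
have cE : ~: (y |: (x |: h)) = ~: h :\ x :\ y.
  by apply/setP => z; rewrite !inE !negb_or andbA.
have [||p pp ph] := IH (y |: (x |: h)).
- rewrite cE; rewrite c1 c2 in hm; rewrite add1n in hm; lia.
- by rewrite cE; move: oh; rewrite c1 c2 !oddD negbK.
have [||qq qh _] := @tperm_join _ p y x pp yx.
- by rewrite ph !inE eqxx.
- by rewrite ph !inE eqxx orbT.
exists (p * tperm y x)%g => //; rewrite qh ph; apply/setP => z; rewrite !inE.
have [->|zx] := eqVneq z x; first by move: xh; rewrite inE => /negbTE.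
by have [->|zy] := eqVneq z y; [move: yh; rewrite inE => /negbTE|].
Qed.

Lemma exists_involution_swap (K : finType) (h : {set K}) (x y : K) :
  ~~ odd #|~: h| -> x \notin h -> y \notin h -> x != y ->
  exists p : {perm K}, [/\ forall z, p (p z) = z, fixset p = h & p x = y].
Proof.
move=> oh xh yh xy.
have [|p pp ph] := @exists_involution _ (x |: (y |: h)).
  have cU : #|x |: (y |: h)| = #|h|.+2.
    by rewrite !cardsU1 !inE negb_or xy xh yh.
  have := cardsC h; rewrite -(cardsC (x |: (y |: h))) cU => c.
  have c2 : #|~: h| = #|~: (x |: (y |: h))|.+2 by lia.
  by move: oh; rewrite c2 /= negbK.
have [||qq qh qx] := tperm_join pp xy; rewrite ?ph ?inE ?eqxx ?orbT //.
exists (p * tperm x y)%g; split=> //; rewrite qh ph; apply/setP => z.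
rewrite !inE; have [->|zy] := eqVneq z y; first by rewrite (negbTE yh).
by have [->|zx] := eqVneq z x; first by rewrite (negbTE xh).
Qed.

(** The 2-cycles of [p] inside [a] are removed one by one, each removal undoing a flip at cost [D];
    [#|K|.+1] is a crude bound on their number. *)
Lemma flip_chain_set (R : realFieldType) (K : finType) (p : {perm K})
    (fp D : R) (g : {set K} -> R) (a : {set K}) :
  (forall x, p (p x) = x) -> (forall x, x \in a -> p x \in a) ->
  #|a :&: fixset p| = 1%N \/ #|a :&: fixset p| = 3%N -> 0 <= fp -> 0 <= D ->
  (forall a i, flippable p a i -> fp * `|g a - g (i |: (p i |: a))| <= D) ->
  fp * `|g a - g (a :&: fixset p)| <= #|K|.+1%:R * D.
Proof.
move=> pp + + fp0 D0 hD.
suff main m (b : {set K}) : (#|b :\: fixset p| < m)%N ->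
    (forall x, x \in b -> p x \in b) ->
    #|b :&: fixset p| = 1%N \/ #|b :&: fixset p| = 3%N ->
    fp * `|g b - g (b :&: fixset p)| <= m%:R * D.
  by apply: main; rewrite ltnS max_card.
elim: m b => // m IH b bm bp b13.
have [b0|[x]] := set_0Vmem (b :\: fixset p).
  have -> : b :&: fixset p = b.
    by apply/setIidPl; rewrite -setD_eq0 b0.
  by rewrite subrr normr0 mulr0 mulr_ge0.
rewrite !inE => /andP[pxx xb].
have pxb := bp _ xb.
pose b' := b :\ x :\ p x.
have bE : b = x |: (p x |: b').
  by rewrite /b' setD1K ?setD1K // !inE pxx.
have bI : b' :&: fixset p = b :&: fixset p.
  apply/setP => z; rewrite !inE; have [->|zpx] := eqVneq z (p x).
    by rewrite pp [x == _]eq_sym (negbTE pxx) !andbF.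
  by have [->|zx] := eqVneq z x; first rewrite (negbTE pxx) !andbF.
have b'p z : z \in b' -> p z \in b'.
  rewrite !inE => /and3P[zpx zx /bp ->].
  rewrite (inj_eq perm_inj) zx (can2_eq pp pp) zpx //.
have flip : flippable p b' x.
  apply/and5P; split=> //.
  - by apply/forallP => z; rewrite pp.
  - by apply/forall_inP.
  - by rewrite !inE eqxx andbF.
  - by rewrite bI; case: b13 => ->.
have := hD _ _ flip; rewrite -bE => h1.
have : fp * `|g b' - g (b' :&: fixset p)| <= m%:R * D.
  apply: IH => //; last by rewrite bI.
  rewrite -ltnS; apply: leq_trans bm; rewrite ltnS; apply: proper_card.
  apply/properP; split.
    by apply: setSD; apply/subsetP => z; rewrite !inE => /and3P[].
  by exists x; rewrite !inE ?pxx ?xb // eqxx andbF.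
rewrite bI => h2.
rewrite -natr1 mulrDl mul1r; apply: le_trans (lerD h2 h1).
by rewrite -mulrDr ler_wpM2l // [leRHS]addrC (distrC (g b') (g b)) ler_distD.
Qed.

(** The 2-cycles of [p] are split one by one until the identity remains, every split being a
    flip. *)
Lemma flip_chain_perm (R : realFieldType) (K : finType) (p : {perm K})
    (ga D : R) (f : {perm K} -> R) (a : {set K}) :
  (forall x, p (p x) = x) -> a \subset fixset p ->
  #|a| = 1%N \/ #|a| = 3%N -> 0 <= ga -> 0 <= D ->
  (forall p i, flippable p a i -> ga * `|f p - f (p * tperm i (p i))%g| <= D) ->
  ga * `|f p - f 1%g| <= #|K|.+1%:R * D.
Proof.
move=> + + a13 ga0 D0 hD.
suff main m (q : {perm K}) : (#|~: fixset q| < m)%N ->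
    (forall x, q (q x) = x) -> a \subset fixset q ->
    ga * `|f q - f 1%g| <= m%:R * D.
  by apply: main; rewrite ltnS max_card.
elim: m q => // m IH q qm qq aq.
have [q0|[x]] := set_0Vmem (~: fixset q).
  have -> : q = 1%g.
    apply/permP => x; rewrite perm1; have : x \notin ~: fixset q by rewrite q0 inE.
    by rewrite !inE negbK => /eqP.
  by rewrite subrr normr0 mulr0 mulr_ge0.
rewrite !inE => qx.
have [rr rE] := tperm_split x qq.
set r := (q * tperm x (q x))%g in rr rE.
have aI : a :&: fixset q = a by apply/setIidPl.
have flip : flippable q a x.
  apply/and5P; split=> //.
  - by apply/forallP => z; rewrite qq.
  - by apply/forall_inP => z za; move/subsetP: aq => /(_ z za); rewrite inE => /eqP ->.
  - by apply/negP => /(subsetP aq); rewrite inE (negbTE qx).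
  - by rewrite aI; case: a13 => ->.
have h1 := hD _ _ flip; rewrite -/r in h1.
have h2 : ga * `|f r - f 1%g| <= m%:R * D.
  apply: IH => //; last by rewrite rE (subset_trans aq) // setUA subsetUr.
  rewrite -ltnS; apply: leq_trans qm; rewrite ltnS; apply: proper_card.
  rewrite rE; apply/properP; split.
    by rewrite setCS setUA subsetUr.
  by exists x; rewrite !inE ?qx // eqxx.
rewrite -natr1 mulrDl mul1r; apply: le_trans (lerD h2 h1).
by rewrite -mulrDr ler_wpM2l // [leRHS]addrC ler_distD.
Qed.

(** With [h = a :&: fixset p], flips lead from [(p, a)] to [(p, h)] and on to [(1, h)], each passage
    costing at most [#|K|.+1%:R * D]. The final product is a term of one of the two sums. *)
Lemma local_mass (R : realFieldType) (K : finType) (f : {perm K} -> R)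
    (g : {set K} -> R) (D : R) (p : {perm K}) (a : {set K}) (i : K) :
  (forall p, 0 <= f p) -> (forall a, 0 <= g a) -> 0 <= D ->
  (forall p a i, flippable p a i ->
     f p * `|g a - g (i |: (p i |: a))| <= D) ->
  (forall p a i, flippable p a i ->
     g a * `|f p - f (p * tperm i (p i))%g| <= D) ->
  flippable p a i ->
  f p * g a <= \sum_e f 1%g * g [set e] + \sum_(h : {set K} | #|h| == 3%N) f 1%g * g h
               + #|K|.+1%:R * D *+ 2.
Proof.
move=> f0 g0 D0 hU hM /and5P[/forallP pp /forall_inP ap _ _ /orP aI].
have {}pp x : p (p x) = x by apply/eqP.
have {}aI : #|a :&: fixset p| = 1%N \/ #|a :&: fixset p| = 3%N.
  by case: aI => /eqP; [left|right].
have := flip_chain_set pp ap aI (f0 p) D0 (hU p).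
have := flip_chain_perm pp (subsetIr a _) aI (g0 _) D0 (fun p i => hM p _ i).
set h := a :&: fixset p in aI *; set E := _ * D => h1 h2.
have h3 : f 1%g * g h <=
    \sum_e f 1%g * g [set e] + \sum_(h : {set K} | #|h| == 3%N) f 1%g * g h.
  have fg0 h' : 0 <= f 1%g * g h' by rewrite mulr_ge0.
  case: aI => [/eqP/cards1P[e ->]|/eqP aI].
    by rewrite (bigD1 e) //= -addrA lerDl addr_ge0 // sumr_ge0.
  by rewrite addrC (bigD1 h) //= -addrA lerDl addr_ge0 // sumr_ge0.
have h4 : f p * g a <= f p * g h + E.
  apply: le_trans (lerD (lexx _) h2); rewrite -mulrDr ler_wpM2l //.
  by rewrite -lerBlDl ler_norm.
have h5 : g h * f p <= g h * f 1%g + E.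
  apply: le_trans (lerD (lexx _) h1); rewrite -mulrDr ler_wpM2l //.
  by rewrite -lerBlDl ler_norm.
rewrite mulr2n; lra.
Qed.

(* A set [h] of size 1 or 3 is good when [g h >= g [set: K] / 2].  If [D] is
   small, this forces [g h] to be nearly [g [set: K]], and [f p] to be nearly
   [f 1] for every involution [p] with set of fixed points [h]. *)
Lemma local_triples (R : realFieldType) (K : finType) (f : {perm K} -> R)
    (g : {set K} -> R) (D t : R) :
  odd #|K| -> (5 <= #|K|)%N -> 0 < t <= 8^-1 ->
  (forall p, 0 <= f p) -> (forall a, 0 <= g a) -> 0 <= D ->
  (forall p a i, flippable p a i ->
     f p * `|g a - g (i |: (p i |: a))| <= D) ->
  (forall p a i, flippable p a i ->
     g a * `|f p - f (p * tperm i (p i))%g| <= D) ->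
  \sum_(h : {set K} | #|h| == 3%N) f 1%g * g h <=
    #|K|%:R * 2 * (f 1%g * g [set: K])
    + 'C(#|K|.-1, 2)%:R * (1 + 8 * t) * \sum_e f 1%g * g [set e]
    + 'C(#|K|, 3)%:R * ((2 / t + 3) * (#|K|.+1%:R * D)).
Proof.
move=> oK K5 /andP[t0 t8] f0 g0 D0 hU hM.
set F := f 1%g; set G := g [set: K]; set E := _ * D.
have E0 : 0 <= E by rewrite mulr_ge0.
have F0 : 0 <= F := f0 _.
have G0 : 0 <= G := g0 _.
have fixP (p : {perm K}) (h : {set K}) : (forall x, p (p x) = x) -> fixset p = h ->
    #|h| = 1%N \/ #|h| = 3%N -> g h * `|f p - F| <= E.
  move=> pp ph h13; apply: (@flip_chain_perm _ _ p _ _ _ h) => //; first by rewrite ph.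
  by move=> q i; apply: hM.
have chainS (p : {perm K}) (h a : {set K}) : (forall x, p (p x) = x) -> fixset p = h ->
    #|h| = 1%N \/ #|h| = 3%N -> (forall x, x \in a -> p x \in a) -> h \subset a ->
    f p * `|g a - g h| <= E.
  move=> pp ph h13 ap ha.
  have aI : a :&: fixset p = h by rewrite ph; apply/setIidPr.
  by rewrite -{1}aI; apply: (flip_chain_set pp) => //; [rewrite aI | exact: hU].
have oC (h : {set K}) : #|h| = 1%N \/ #|h| = 3%N -> ~~ odd #|~: h|.
  by move=> h13; have := cardsC h; case: h13 => -> c; move: oK; rewrite -c oddD.
have cut (h : {set K}) : #|h| = 3%N -> F * g h <= F * G *+ 2 + 3 * E.
  move=> h3; have h13 : #|h| = 1%N \/ #|h| = 3%N by right.
  have [p pp ph] := exists_involution (oC _ h13).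
  have h1 := fixP _ _ pp ph h13.
  have h2 := chainS _ _ [set: K] pp ph h13 (fun x _ => in_setT _) (subsetT _).
  have h3' : g h * (F - f p) <= E.
    by apply: le_trans h1; rewrite ler_wpM2l // distrC ler_norm.
  have h4 : f p * (g h - G) <= E.
    by apply: le_trans h2; rewrite ler_wpM2l // distrC ler_norm.
  have [gh|gh] := lerP (g h) (G * 2).
    have := ler_wpM2l F0 gh; rewrite mulr2n; lra.
  have := f0 p; have FG0 := mulr_ge0 F0 G0; rewrite mulr2n => fp0.
  have : f p * (G * 2) <= f p * g h by rewrite ler_wpM2l // ltW.
  lra.
have triples : #|[set h : {set K} | #|h| == 3%N]| = 'C(#|K|, 3).
  rewrite -cardsT -cards_draws; apply: eq_card => h; by rewrite !inE subsetT.
have sum3 x : \sum_(h : {set K} | #|h| == 3%N) x = 'C(#|K|, 3)%:R * x.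
  rewrite (eq_bigl (fun h => h \in [set h : {set K} | #|h| == 3%N])).
    by rewrite sumr_const triples mulr_natl.
  by move=> h; rewrite inE.
have X1 : 0 <= \sum_e F * g [set e] by apply: sumr_ge0 => e _; rewrite mulr_ge0.
have it0 : 0 < t^-1 by rewrite invr_gt0.
(* If [E] is at least [t * (F * G)], the bound [cut] suffices; otherwise [F] and [G] are positive
   and [E] is small relative to [F * G]. *)
have [EFG|FGE] := ltP E (t * (F * G)); last first.
  have h1 : \sum_(h : {set K} | #|h| == 3%N) F * g h <=
      'C(#|K|, 3)%:R * ((2 / t + 3) * E).
    rewrite -sum3; apply: ler_sum => h /eqP h3; apply: le_trans (cut _ h3) _.
    have : F * G <= E / t by rewrite ler_pdivlMr // mulrC.
    by rewrite mulr2n; lra.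
  apply: le_trans h1 _; rewrite lerDr addr_ge0 // !mulr_ge0 //.
  lra.
have FG : 0 < F * G by rewrite -(pmulr_rgt0 _ t0); apply: le_lt_trans EFG.
have Fp : 0 < F.
  by rewrite lt_neqAle F0 andbT; apply: contraTneq FG => <-; rewrite mul0r ltxx.
have Gp : 0 < G.
  by rewrite lt_neqAle G0 andbT; apply: contraTneq FG => <-; rewrite mulr0 ltxx.
pose good (h : {set K}) := G <= g h * 2.
have near_f (p : {perm K}) (h : {set K}) : (forall x, p (p x) = x) -> fixset p = h ->
    #|h| = 1%N \/ #|h| = 3%N -> good h -> F <= f p * 2.
  move=> pp ph h13 gh; have h1 := fixP _ _ pp ph h13.
  have : G * `|f p - F| <= G * (2 * t * F).
    apply: le_trans (_ : g h * 2 * `|f p - F| <= _); first by rewrite ler_wpM2r.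
    lra.
  rewrite ler_pM2l // => h2.
  have h3 : F - f p <= `|f p - F| by rewrite distrC ler_norm.
  have : t * F <= 8^-1 * F by rewrite ler_wpM2r.
  lra.
have near_g (p : {perm K}) (h a : {set K}) : (forall x, p (p x) = x) -> fixset p = h ->
    #|h| = 1%N \/ #|h| = 3%N -> (forall x, x \in a -> p x \in a) -> h \subset a ->
    F <= f p * 2 -> `|g a - g h| <= 2 * t * G.
  move=> pp ph h13 ap ha fp; have h1 := chainS _ _ _ pp ph h13 ap ha.
  rewrite -(ler_pM2l Fp).
  apply: le_trans (_ : f p * 2 * `|g a - g h| <= _); first by rewrite ler_wpM2r.
  lra.
have goodE (h : {set K}) : #|h| = 1%N \/ #|h| = 3%N -> good h ->
    `|G - g h| <= 2 * t * G.
  move=> h13 gh; have [p pp ph] := exists_involution (oC _ h13).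
  apply: (near_g _ _ _ pp ph) => //; exact: (near_f _ _ pp ph).
have tG : t * G <= 8^-1 * G by rewrite ler_wpM2r.
(* If [g h < G / 2], the flips force [f p] to be small against [F], and then [F * g h] is itself an
   error term. *)
have bad (h : {set K}) : #|h| = 3%N -> ~~ good h -> F * g h <= 2 * E.
  move=> h3; rewrite -ltNge => gh; have h13 : #|h| = 1%N \/ #|h| = 3%N by right.
  have [p pp ph] := exists_involution (oC _ h13).
  have h1 := fixP _ _ pp ph h13.
  have h2 := chainS _ _ [set: K] pp ph h13 (fun x _ => in_setT _) (subsetT _).
  have h3' : g h * (F - f p) <= E.
    by apply: le_trans h1; rewrite ler_wpM2l // distrC ler_norm.
  have h4 : f p * (G - g h) <= E.
    by apply: le_trans h2; rewrite ler_wpM2l // ler_norm.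
  have h5 : f p * (G - g h * 2) >= 0 by rewrite mulr_ge0 // subr_ge0 ltW.
  have h6 : f p <= 2 * t * F.
    rewrite -(ler_pM2r Gp); lra.
  have h7 : t * F <= 8^-1 * F by rewrite ler_wpM2r.
  have h8 : g h * (F - f p * 2) >= 0 by rewrite mulr_ge0 // subr_ge0; lra.
  lra.
(* The involution fixes exactly [h'] and exchanges the other two elements [x], [y] of [h]. It
   preserves [h] and fixes only [e] in it, so a chain of flips compares [h] with [[set e]]. *)
have meet e (h h' : {set K}) : #|h| = 3%N -> #|h'| = 1%N \/ #|h'| = 3%N ->
    h :&: h' = [set e] -> good h -> good h' -> good [set e].
  move=> h3 h'13 he gh gh'.
  have /setIP[eh eh'] : e \in h :&: h' by rewrite he set11.
  have /cards2P[x [y [xy hE]]] : #|h :\ e| == 2%N.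
    by have := cardsD1 e h; rewrite eh h3 add1n => -[<-].
  have hin z : z \in h :\ e -> z \notin h'.
    rewrite !inE => /andP[ze zh]; apply: contra ze => zh'.
    by rewrite -in_set1 -he inE zh.
  have xh' : x \notin h' by apply: hin; rewrite hE !inE eqxx.
  have yh' : y \notin h' by apply: hin; rewrite hE !inE eqxx orbT.
  have [p [pp ph px]] := exists_involution_swap (oC _ h'13) xh' yh' xy.
  have hexy : h = [set e; x; y] by rewrite -(setD1K eh) hE setUA.
  have pe : p e = e by move: eh'; rewrite -ph inE => /eqP.
  have hp z : z \in h -> p z \in h.
    rewrite hexy !inE => /orP[/orP[]|] /eqP ->.
    - by rewrite pe eqxx.
    - by rewrite px eqxx orbT.
    - by rewrite -px pp eqxx orbT.
  have fp := near_f _ _ pp ph h'13 gh'.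
  have hI : h :&: fixset p = [set e] by rewrite ph.
  have h1 : f p * `|g h - g [set e]| <= E.
    rewrite -hI; apply: (flip_chain_set pp) => //; last exact: hU.
    by rewrite hI cards1; left.
  have : F * `|g h - g [set e]| <= F * (2 * t * G).
    apply: le_trans (_ : f p * 2 * `|g h - g [set e]| <= _).
      by rewrite ler_wpM2r.
    lra.
  rewrite ler_pM2l // => h2.
  have h3' := goodE _ (or_intror h3) gh.
  have := ler_norm (G - g h); have := ler_norm (g h - g [set e]).
  rewrite /good; lra.
(* Now [e] is the only fixed point and the other two elements of [h] are exchanged, so [h] is
   preserved and [g h] is close to [g [set e]]. *)
have up e (h : {set K}) : #|h| = 3%N -> e \in h -> good [set e] -> good h.
  move=> h3 eh ge; have e13 : #|[set e]| = 1%N \/ #|[set e]| = 3%N.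
    by left; rewrite cards1.
  have /cards2P[x [y [xy hE]]] : #|h :\ e| == 2%N.
    by have := cardsD1 e h; rewrite eh h3 add1n => -[<-].
  have hexy : h = [set e; x; y] by rewrite -(setD1K eh) hE setUA.
  have xe : x \notin [set e].
    by have : x \in h :\ e by [rewrite hE !inE eqxx]; rewrite !inE => /andP[].
  have ye : y \notin [set e].
    by have : y \in h :\ e by [rewrite hE !inE eqxx orbT]; rewrite !inE => /andP[].
  have [p [pp ph px]] := exists_involution_swap (oC _ e13) xe ye xy.
  have pe : p e = e by have := set11 e; rewrite -{1}ph inE => /eqP.
  have hp z : z \in h -> p z \in h.
    rewrite hexy !inE => /orP[/orP[]|] /eqP ->.
    - by rewrite pe eqxx.
    - by rewrite px eqxx orbT.
    - by rewrite -px pp eqxx orbT.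
  have fp := near_f _ _ pp ph e13 ge.
  have h1 : `|g h - g [set e]| <= 2 * t * G.
    by apply: (near_g _ _ _ pp ph) => //; rewrite sub1set.
  have h2 := goodE _ e13 ge.
  have := ler_norm (G - g [set e]); have := ler_norm (g [set e] - g h).
  rewrite /good distrC; lra.
have cardg := card_good_triples K5 meet up.
set s := #|[set e : K | good [set e]]| in cardg.
have sX1 : s%:R * ((1 - 2 * t) * (F * G)) <= \sum_e F * g [set e].
  rewrite mulr_natl -sumr_const.
  rewrite [leRHS](bigID (fun e => e \in [set e : K | good [set e]])) /=.
  rewrite -[leLHS]addr0 lerD //; last by apply: sumr_ge0 => e _; rewrite mulr_ge0.
  apply: ler_sum => e; rewrite inE => ge.
  have h2 : `|G - g [set e]| <= 2 * t * G by apply: goodE => //; left; rewrite cards1.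
  have h3 := le_trans (ler_norm _) h2.
  have : F * (G - g [set e]) <= F * (2 * t * G) by rewrite ler_wpM2l.
  lra.
rewrite (bigID good) /=.
have hgood : \sum_(h : {set K} | (#|h| == 3%N) && good h) F * g h <=
    (#|K| + s * 'C(#|K|.-1, 2))%:R * ((1 + 2 * t) * (F * G)).
  apply: (@le_trans _ _ (#|[set h : {set K} | good h && (#|h| == 3%N)]|%:R
     * ((1 + 2 * t) * (F * G)))); last first.
    rewrite ler_wpM2r ?ler_nat // mulr_ge0 ?(ltW FG) //; lra.
  rewrite mulr_natl -sumr_const.
  rewrite (eq_bigl
    (fun h => h \in [set h : {set K} | good h && (#|h| == 3%N)])); last first.
    by move=> h; rewrite inE andbC.
  apply: ler_sum => h; rewrite inE => /andP[gh /eqP h3].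
  have h4 := le_trans (ler_norm _) (goodE _ (or_intror h3) gh).
  have h5 := goodE _ (or_intror h3) gh; rewrite distrC in h5.
  have h6 := le_trans (ler_norm _) h5.
  have : F * (g h - G) <= F * (2 * t * G) by rewrite ler_wpM2l.
  lra.
have hbad : \sum_(h : {set K} | (#|h| == 3%N) && ~~ good h) F * g h <=
    'C(#|K|, 3)%:R * ((2 / t + 3) * E).
  apply: (@le_trans _ _ (\sum_(h : {set K} | #|h| == 3%N) 2 * E)).
    rewrite [leRHS](bigID good) /= -[leLHS]add0r lerD //.
      by apply: sumr_ge0 => h _; rewrite mulr_ge0.
    by apply: ler_sum => h /andP[/eqP h3]; apply: bad.
  rewrite -sum3; apply: ler_sum => h _; rewrite ler_wpM2r //; lra.
apply: lerD hbad; apply: le_trans hgood _.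
rewrite natrD natrM mulrDl; apply: lerD.
  rewrite -mulrA ler_wpM2l // ler_wpM2r ?(ltW FG) //; lra.
rewrite -!mulrA [leLHS]mulrCA ler_wpM2l //.
apply: le_trans (_ : (1 + 8 * t) * (s%:R * ((1 - 2 * t) * (F * G))) <= _); last first.
  rewrite ler_wpM2l //; lra.
rewrite [leRHS]mulrCA ler_wpM2l // [leRHS]mulrA ler_wpM2r ?(ltW FG) //.
(* Up to the factor 16, this is the difference of [(1 + 8 * t) * (1 - 2 * t)] and [1 + 2 * t]. *)
have : 0 <= t * (4^-1 - t) by rewrite mulr_ge0 //; lra.
lra.
Qed.

(** * Random bits *)

(** Since [expR (- z)] is at least [1 - z], it suffices that the quadratic times [1 - z] is at least
    1; the excess is [z ^+ 2 * (1 - 2 * z)]. *)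
Lemma expR_le_quad (R : realType) (z : R) :
  `|z| <= 2^-1 -> expR z <= 1 + z + 2 * z ^+ 2.
Proof.
rewrite ler_norml => /andP[z1 z2].
have z3 : 0 < 1 - z by lra.
have : 1 - z <= expR (- z) by have := expR_ge1Dx (- z).
rewrite expRN => h.
have : expR z <= (1 - z)^-1.
  by rewrite -[expR z]invrK lef_pV2 ?posrE ?invr_gt0 ?expR_gt0.
move=> /le_trans; apply; rewrite -[leLHS]mul1r ler_pdivrMr //.
have : 0 <= z ^+ 2 * (1 - 2 * z) by rewrite mulr_ge0 ?sqr_ge0 //; lra.
by rewrite !expr2; lra.
Qed.

(** The exponential factors over the coordinates; each factor [expR t + expR (- t)] is at most
    [2 * expR (2 * t ^+ 2)]. *)
Lemma chernoff_mgf (R : realType) (I : finType) (s : I -> bool) (t : R) :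
  `|t| <= 2^-1 ->
  \sum_(x : {ffun I -> bool}) expR (t * \sum_i (-1) ^+ (s i (+) x i)) <=
  2 ^+ #|I| * expR (2 * t ^+ 2 * #|I|%:R).
Proof.
move=> t12.
under eq_bigr => x _ do rewrite mulr_sumr expR_sum.
rewrite -(bigA_distr_bigA (fun i b => expR (t * (-1) ^+ (s i (+) b)))) /=.
rewrite expRM_natr -exprMn.
have -> : (2 * expR (2 * t ^+ 2)) ^+ #|I| = \prod_(i : I) (2 * expR (2 * t ^+ 2)).
  by rewrite prodr_const.
apply: ler_prod => i _; rewrite sumr_ge0 => [|b _]; last exact: expR_ge0.
have -> : \sum_b expR (t * (-1) ^+ (s i (+) b)) = expR t + expR (- t).
  by rewrite big_bool; case: (s i); rewrite /= ?expr0 ?expr1 mulr1 mulrN1 // addrC.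
have := expR_le_quad t12; have := @expR_le_quad _ (- t).
rewrite normrN sqrrN => /(_ t12); have := expR_ge1Dx (2 * t ^+ 2); lra.
Qed.

Lemma chernoff_signed (R : realType) (I : finType) (e B : R) (s : I -> bool)
    (X : {ffun I -> bool} -> R) :
  0 <= e <= 1 -> (forall x, 0 <= X x <= B) ->
  \sum_x X x * \sum_i (-1) ^+ (s i (+) x i) <=
  #|I|%:R * (e * \sum_x X x + B * 2 ^+ #|I| * expR (- (e ^+ 2 / 8 * #|I|%:R))).
Proof.
move=> /andP[e0 e1] XB; set m := #|I|%:R.
pose y (x : {ffun I -> bool}) : R := \sum_i (-1) ^+ (s i (+) x i).
have m0 : 0 <= m by rewrite ler0n.
have B0 : 0 <= B by have /andP[/le_trans] := XB [ffun=> true]; apply.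
(* This [t] minimizes the exponent [2 * t ^+ 2 - t * e], whose minimum is [- (e ^+ 2 / 8)]. *)
pose t := e / 4.
have ym x : y x <= m.
  rewrite /y /m -sum1_card natr_sum; apply: ler_sum => i _.
  by case: (_ (+) _); rewrite ?expr0 // expr1; lra.
(* Beyond the threshold [e * m] the exponential is at least 1 and [y x] is at most [m]. *)
have yE x : y x <= e * m + m * expR (t * (y x - e * m)).
  have [h|h] := leP (y x) (e * m).
    by apply: le_trans h _; rewrite lerDl mulr_ge0 ?expR_ge0.
  have : 0 <= t * (y x - e * m) by rewrite mulr_ge0 //; rewrite /t; lra.
  move=> h1; have := expR_ge1Dx (t * (y x - e * m)) => h2.
  have : m * 1 <= m * expR (t * (y x - e * m)) by rewrite ler_wpM2l //; lra.
  have := ym x; have := mulr_ge0 e0 m0; lra.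
apply: (@le_trans _ _ (\sum_x (X x * (e * m) +
   B * m * expR (- (t * e * m)) * expR (t * y x)))).
  apply: ler_sum => x _; rewrite -/(y x); have /andP[X0 XB'] := XB x.
  apply: le_trans (ler_wpM2l X0 (yE x)) _; rewrite mulrDr lerD2l.
  have -> : B * m * expR (- (t * e * m)) * expR (t * y x) =
      B * (m * expR (t * (y x - e * m))).
    by rewrite -!mulrA -expRD; congr (_ * (_ * expR _)); ring.
  by rewrite ler_wpM2r // mulr_ge0 ?expR_ge0.
rewrite big_split /= -mulr_suml -mulr_sumr mulrDr; apply: lerD.
  by rewrite mulrC mulrAC mulrC mulrCA mulrA.
have t12 : `|t| <= 2^-1 by rewrite ger0_norm /t; lra.
have := chernoff_mgf s t12; rewrite -/m => h.
apply: le_trans (ler_wpM2l _ h) _.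
  by rewrite !mulr_ge0 ?expR_ge0.
have -> : expR (- (e ^+ 2 / 8 * m)) =
    expR (- (t * e * m)) * expR (2 * t ^+ 2 * m).
  by rewrite -expRD; congr expR; rewrite /t; field.
by rewrite le_eqVlt; apply/orP; left; apply/eqP; ring.
Qed.

(** A suitable choice of the signs [s] turns the sum of absolute values into one signed sum. *)
Lemma chernoff_sum (R : realType) (I : finType) (e B : R)
    (X : {ffun I -> bool} -> R) :
  0 <= e <= 1 -> (forall x, 0 <= X x <= B) ->
  \sum_i `|\sum_x X x * (-1) ^+ x i| <=
  #|I|%:R * (e * \sum_x X x + B * 2 ^+ #|I| * expR (- (e ^+ 2 / 8 * #|I|%:R))).
Proof.
move=> e01 XB.
pose s i := \sum_x X x * (-1) ^+ x i < 0.
apply: le_trans (chernoff_signed s e01 XB).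
under [leRHS]eq_bigr => x _ do rewrite mulr_sumr.
rewrite exchange_big /=; apply: ler_sum => i _.
rewrite normrEsign -/(s i) mulr_sumr le_eqVlt; apply/orP; left; apply/eqP.
by apply: eq_bigr => x _; rewrite signr_addb mulrCA.
Qed.

(** * Exchange of a special bit with a random bit *)

Definition cube_avg (R : realType) (I : finType) (F : {ffun I -> bool} -> R) : R :=
  (2 ^+ #|I|)^-1 * \sum_x F x.

Definition upd (I : finType) (x : {ffun I -> bool}) (s : I) (b : bool) :
    {ffun I -> bool} :=
  [ffun i => if i == s then b else x i].

(** For each value [c] of the bit [s], the update maps the face [x s == c] bijectively onto the face
    [x s == b]; the old value survives as the first argument of [F]. *)
Lemma sum_upd (R : realType) (I : finType) (s : I) (b : bool)
    (F : bool -> {ffun I -> bool} -> R) :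
  \sum_(x : {ffun I -> bool}) F (x s) (upd x s b) =
    \sum_(x : {ffun I -> bool} | x s == b) (F false x + F true x).
Proof.
have main c : \sum_(x : {ffun I -> bool} | x s == c) F c (upd x s b) =
    \sum_(x : {ffun I -> bool} | x s == b) F c x.
  rewrite [RHS](reindex_onto (fun x => upd x s b) (fun x => upd x s c)) /=.
    apply: eq_bigl => x; rewrite ffunE !eqxx /=.
    apply/eqP/eqP => [xs|<-]; last by rewrite ffunE eqxx.
    apply/ffunP => i; rewrite !ffunE; case: eqP => // ->; exact/esym.
  move=> x /eqP xs; apply/ffunP => i; rewrite !ffunE.
  by case: eqP => // ->; exact/esym.
rewrite (bigID (fun x : {ffun I -> bool} => x s == false)) /= big_split /=.
rewrite -!main; congr (_ + _).
  by apply: eq_bigr => x /eqP ->.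
apply: eq_big => [x|x]; first by case: (x s).
by case: (x s).
Qed.

(* [Psi sg b x] is a function of one special bit [b] and of the bits [x]; the
   action of [tau s] exchanges the special bit with the bit [s] and preserves
   [phi].  As [s] varies the special bit thus becomes a typical bit. *)
Lemma special_bit (R : realType) (I P : finType) (e : R) (tau : I -> P -> P)
    (phi : P -> R) (Psi : P -> bool -> {ffun I -> bool} -> R) :
  (0 < #|I|)%N -> 0 <= e <= 1 -> (forall s, injective (tau s)) ->
  (forall p, 0 <= phi p <= 1) -> (forall p b x, 0 <= Psi p b x <= 1) ->
  (forall s p, phi (tau s p) = phi p) ->
  (forall s p b x, Psi (tau s p) b x = Psi p (x s) (upd x s b)) ->
  \sum_p phi p * `|cube_avg (Psi p false) - cube_avg (Psi p true)| <=
  e * \sum_p phi p * (cube_avg (Psi p false) + cube_avg (Psi p true))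
  + #|P|%:R * (2 * expR (- (e ^+ 2 / 8 * #|I|%:R))).
Proof.
move=> I0 e01 tauI phi01 Psi01 phiE PsiE.
set m : R := #|I|%:R; have m0 : 0 < m by rewrite ltr0n.
pose N : R := 2 ^+ #|I|; have N0 : 0 < N by rewrite exprn_gt0.
pose X p x := Psi p false x + Psi p true x.
(* By the symmetry [tau s], the effect of the special bit equals the bias of the bit [s], whatever
   [s] is. *)
have swap s : \sum_p phi p * `|cube_avg (Psi p false) - cube_avg (Psi p true)| =
    \sum_p phi p * (N^-1 * `|\sum_x X p x * (-1) ^+ x s|).
  rewrite (reindex_inj (tauI s)); apply: eq_bigr => p _; rewrite phiE.
  congr (_ * _); rewrite /cube_avg -/N -mulrBr normrM gtr0_norm ?invr_gt0 //.
  congr (_ * `|_|).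
  under eq_bigr => x _ do rewrite PsiE.
  under [X in _ - X]eq_bigr => x _ do rewrite PsiE.
  rewrite !(sum_upd s _ (Psi p)).
  rewrite [RHS](bigID (fun x : {ffun I -> bool} => x s == false)) /=.
  congr (_ + _); first by apply: eq_bigr => x /eqP ->; rewrite mulr1.
  rewrite -sumrN; apply: eq_big => [x|x]; first by case: (x s).
  by move/eqP=> ->; rewrite expr1 mulrN1.
(* Averaging [swap] over all [s] leaves the total bias of the bits, to which [chernoff_sum]
   applies. *)
rewrite -(ler_pM2l m0) -{1}/m.
have -> : m * (\sum_p phi p * `|cube_avg (Psi p false) - cube_avg (Psi p true)|) =
    \sum_p phi p * (N^-1 * \sum_s `|\sum_x X p x * (-1) ^+ x s|).
  transitivity (\sum_(s : I) \sum_p phi p * (N^-1 * `|\sum_x X p x * (-1) ^+ x s|)).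
    by rewrite -(eq_bigr _ (fun s _ => swap s)) sumr_const mulr_natl.
  by rewrite exchange_big /=; apply: eq_bigr => p _; rewrite -!mulr_sumr.
have -> : m * (e * (\sum_p phi p * (cube_avg (Psi p false) + cube_avg (Psi p true))) +
     #|P|%:R * (2 * expR (- (e ^+ 2 / 8 * m)))) =
   \sum_p (phi p * (N^-1 * (m * (e * \sum_x X p x))) +
     m * (2 * expR (- (e ^+ 2 / 8 * m)))).
  rewrite big_split /= sumr_const -[in RHS]mulr_natl mulrDr.
  congr (_ + _); last by ring.
  rewrite !mulr_sumr; apply: eq_bigr => p _.
  rewrite /cube_avg -/N /X big_split /=; ring.
apply: ler_sum => p _; have /andP[p0 p1] := phi01 p.
have X2 x : 0 <= X p x <= 2.
  have /andP[? ?] := Psi01 p false x; have /andP[? ?] := Psi01 p true x.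
  by rewrite /X; lra.
have h := chernoff_sum e01 X2; rewrite -/m -/N in h.
have h2 : N^-1 * (\sum_i `|\sum_x X p x * (-1) ^+ x i|) <=
    N^-1 * (m * (e * \sum_x X p x)) + m * (2 * expR (- (e ^+ 2 / 8 * m))).
  apply: le_trans (ler_wpM2l _ h) _; first by rewrite invr_ge0 ltW.
  rewrite mulrDr mulrDr lerD2l le_eqVlt; apply/orP; left; apply/eqP.
  by field; rewrite gt_eqF.
apply: le_trans (ler_wpM2l p0 h2) _; rewrite mulrDr lerD2l ler_piMl //.
by rewrite !mulr_ge0 ?expR_ge0 // ltW.
Qed.

(** * Random embeddings of the gadget *)

(* The vertices are the [c_i = inl (false, i)] and [d_i = inl (true, i)] for
   [i : K], a pair for each element of [I] and a 4-set for each element of [J].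
   The set [upat a x] consists of the [c_i] with [i \in a] and of the pairs
   selected by [x].  For an involution [p], the matching [mpat p y] contains
   [c_i d_i] for the fixed points of [p], [c_i c_(p i)] and [d_i d_(p i)] for
   the other [i], all the pairs, and one of two perfect matchings of each 4-set,
   chosen by [y].  If [p] preserves [a], then [#|a :&: fixset p|] edges cross. *)
Definition label (K I J : finType) : finType :=
  ((bool * K) + ((I * bool) + (J * (bool * bool))))%type.

Definition upat (K I J : finType) (a : {set K}) (x : {ffun I -> bool}) :
    {set label K I J} :=
  [set l : label K I J | match l with
    | inl (d, i) => ~~ d && (i \in a)
    | inr (inl (j, _)) => x j
    | inr (inr _) => false end].

Definition mate (K I J : finType) (p : {perm K}) (y : {ffun J -> bool})
    (l : label K I J) : label K I J :=
  match l with
  | inl (d, i) => if p i == i then inl (~~ d, i) else inl (d, p i)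
  | inr (inl (j, b)) => inr (inl (j, ~~ b))
  | inr (inr (j, (b, d))) =>
      inr (inr (j, if y j then (~~ b, d) else (b, ~~ d))) end.

Definition mpat (K I J : finType) (p : {perm K}) (y : {ffun J -> bool}) :
    {set {set label K I J}} :=
  [set [set l; mate p y l] | l : label K I J].

Definition uval (R : realType) (K I J : finType) (u : {set label K I J} -> R)
    (sg : {perm label K I J}) (a : {set K}) : R :=
  cube_avg (fun x => u (sg @: upat J a x)).

Definition mval (R : realType) (K I J : finType)
    (v : {set {set label K I J}} -> R) (sg : {perm label K I J})
    (p : {perm K}) : R :=
  cube_avg (fun y => v [set sg @: e | e : {set label K I J} in mpat I p y]).

Lemma imset_mpat (K I J : finType) (q : {perm label K I J}) p y p' y' :
  (forall l, mate p' y' (q l) = q (mate p y l)) ->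
  [set q @: e | e : {set label K I J} in mpat I p y] = mpat I p' y'.
Proof.
move=> h; rewrite /mpat; apply/setP => e; apply/imsetP/imsetP.
  move=> [_ /imsetP[l _ ->] ->]; exists (q l) => //.
  by rewrite imsetU !imset_set1 h.
move=> [l _ ->]; exists [set q^-1 l; mate p y (q^-1 l)]%g.
  by apply/imsetP; exists (q^-1 l)%g.
by rewrite imsetU !imset_set1 -h permKV.
Qed.

Lemma imset_involution (T : finType) (q : {perm T}) (S S' : {set T}) :
  (forall l, q (q l) = l) -> (forall l, (q l \in S) = (l \in S')) ->
  q @: S = S'.
Proof.
move=> qq h; apply/setP => l.
by rewrite -{1}[l]qq mem_imset ?h //; apply: perm_inj.
Qed.

(** Exchanges c_i and c_i' with the two ends of the pair [s]. When [i' = p i], both are edges of the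
    matching, which is thus preserved. *)
Definition swapA_fun (K I J : finType) (i i' : K) (s : I) (l : label K I J) :
    label K I J :=
  match l with
  | inl (false, j) =>
      if j == i then inr (inl (s, false)) else
      if j == i' then inr (inl (s, true)) else l
  | inr (inl (t, b)) =>
      if t == s then inl (false, if b then i' else i) else l
  | _ => l end.

Lemma swapA_funK (K I J : finType) (i i' : K) (s : I) :
  i' != i -> involutive (@swapA_fun K I J i i' s).
Proof.
move=> ii' [[[] j]|[[t b]|[t b]]] //=.
  have [->|ji] := eqVneq j i; first by rewrite /= eqxx.
  have [->|ji'] := eqVneq j i'; first by rewrite /= eqxx.
  by rewrite /= (negbTE ji) (negbTE ji').
have [->|ts] := eqVneq t s; last by rewrite /= (negbTE ts).
by case: b; rewrite /= ?eqxx // (negbTE ii').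
Qed.

(** Exchanges c_i, c_i', d_i, d_i' with the 4-set [s]. When [i' = p i], both quadruples carry one of
    two perfect matchings, and the exchange respects these two kinds. *)
Definition swapB_fun (K I J : finType) (i i' : K) (s : J) (l : label K I J) :
    label K I J :=
  match l with
  | inl (d, j) =>
      if j == i then inr (inr (s, (false, d))) else
      if j == i' then inr (inr (s, (true, d))) else l
  | inr (inr (t, (b, d))) =>
      if t == s then inl (d, if b then i' else i) else l
  | _ => l end.

Lemma swapB_funK (K I J : finType) (i i' : K) (s : J) :
  i' != i -> involutive (@swapB_fun K I J i i' s).
Proof.
move=> ii' [[d j]|[[t b]|[t [b d]]]] //=.
  have [->|ji] := eqVneq j i; first by rewrite /= eqxx.
  have [->|ji'] := eqVneq j i'; first by rewrite /= eqxx.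
  by rewrite /= (negbTE ji) (negbTE ji').
have [->|ts] := eqVneq t s; last by rewrite /= (negbTE ts).
by case: b; rewrite /= ?eqxx // (negbTE ii').
Qed.

Lemma cube_avg01 (R : realType) (I : finType) (F : {ffun I -> bool} -> R) :
  (forall x, 0 <= F x <= 1) -> 0 <= cube_avg F <= 1.
Proof.
move=> F01; rewrite /cube_avg mulr_ge0 ?invr_ge0 ?exprn_ge0 //=; last first.
  by apply: sumr_ge0 => x _; case/andP: (F01 x).
rewrite mulrC ler_pdivrMr ?exprn_gt0 // mul1r.
apply: le_trans (_ : \sum_(x : {ffun I -> bool}) 1 <= _).
  by apply: ler_sum => x _; case/andP: (F01 x).
by rewrite sumr_const card_ffun card_bool natrX.
Qed.

(** The special bit tells whether c_i and c_(p i) lie in the set; [swapA_fun] exchanges it with the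
    bit of a random pair. *)
Lemma flip_set_sum (R : realType) (K I J : finType) (e : R)
    (u : {set label K I J} -> R) (v : {set {set label K I J}} -> R) p a i :
  (0 < #|I|)%N -> 0 <= e <= 1 -> (forall X, 0 <= u X <= 1) ->
  (forall X, 0 <= v X <= 1) -> flippable p a i ->
  \sum_sg mval v sg p * `|uval u sg a - uval u sg (i |: (p i |: a))| <=
  e * \sum_sg mval v sg p * (uval u sg a + uval u sg (i |: (p i |: a)))
  + #|{perm label K I J}|%:R * (2 * expR (- (e ^+ 2 / 8 * #|I|%:R))).
Proof.
move=> I0 e01 u01 v01 flip.
have pia := flippableN flip.
move: flip => /and5P[/forallP pp /forall_inP ap pii ia _].
have {}pp x : p (p x) = x by apply/eqP.
pose tau s : {perm label K I J} := perm (inv_inj (swapA_funK (J := J) s pii)).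
have tauK s l : tau s (tau s l) = l by rewrite !permE; apply: swapA_funK.
pose ab (b : bool) := if b then i |: (p i |: a) else a.
apply: (@special_bit _ _ _ e (fun s sg => (tau s * sg)%g) (mval v ^~ p)
  (fun sg b x => u (sg @: upat J (ab b) x))) => //.
- by move=> s sg sg' /mulgI.
- by move=> sg; apply: cube_avg01 => x.
- move=> s sg; rewrite /mval; congr cube_avg; apply: funext => y; congr v.
  have tE : [set tau s @: E | E : {set label K I J} in mpat I p y] = mpat I p y.
    apply: imset_mpat => l; rewrite !permE.
    case: l => [[[] j]|[[t b]|[t [b d]]]] //=.
    + case: ifP => [/eqP pj /=|//]; have [ji|_] := eqVneq j i.
        by have := pii; rewrite -ji pj eqxx.
      have [ji|//] := eqVneq j (p i).
      by have := pii; rewrite -ji -pj ji pp eqxx.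
    + have [->|ji] := eqVneq j i; first by rewrite (negbTE pii) /= (negbTE pii) eqxx.
      have [->|ji'] := eqVneq j (p i).
        by rewrite /= pp eq_sym (negbTE pii) /= eqxx.
      case: ifP => [pj|pj] /=.
        by rewrite pj /= .
      by rewrite pj /= (can2_eq pp pp) (negbTE ji') (inj_eq perm_inj) (negbTE ji).
    + have [_|ts] := eqVneq t s; last by [].
      by case: b; rewrite /= ?pp ?(negbTE pii) // eq_sym (negbTE pii).
  rewrite -[in RHS]tE -[RHS]imset_comp; apply: eq_imset => E /=.
  by rewrite -imset_comp; apply: eq_imset => l /=; rewrite permM.
- move=> s sg b x; congr u.
  have <- : tau s @: upat J (ab b) x = upat J (ab (x s)) (upd x s b).
    apply: imset_involution => // l; rewrite permE /ab.
    case: l => [[[] j]|[[t c]|[t [c d]]]] //=; rewrite !inE //=.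
    + have [->|ji] := eqVneq j i.
        by case: (x s); rewrite ?inE ?eqxx ?(negbTE ia).
      have [->|ji'] := eqVneq j (p i).
        by case: (x s); rewrite ?inE ?eqxx ?orbT ?(negbTE pia).
      by case: b; case: (x s); rewrite ?inE ?(negbTE ji) ?(negbTE ji').
    + rewrite ffunE; have [_|ts] := eqVneq t s; last by [].
      by case: c; case: b; rewrite ?inE ?eqxx ?orbT ?(negbTE ia) ?(negbTE pia).
  rewrite -imset_comp; apply: eq_imset => l /=; by rewrite permM.
Qed.

(** The special bit tells whether the vertices over [i] and [p i] are matched along the 2-cycle or
    by the edges c_i d_i; [swapB_fun] exchanges it with the bit of a 4-set. None of these vertices
    lies in the set, which is therefore preserved. *)
Lemma flip_perm_sum (R : realType) (K I J : finType) (e : R)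
    (u : {set label K I J} -> R) (v : {set {set label K I J}} -> R) p a i :
  (0 < #|J|)%N -> 0 <= e <= 1 -> (forall X, 0 <= u X <= 1) ->
  (forall X, 0 <= v X <= 1) -> flippable p a i ->
  \sum_sg uval u sg a *
    `|mval v sg p - mval v sg (p * tperm i (p i))%g| <=
  e * \sum_sg uval u sg a * (mval v sg p + mval v sg (p * tperm i (p i))%g)
  + #|{perm label K I J}|%:R * (2 * expR (- (e ^+ 2 / 8 * #|J|%:R))).
Proof.
move=> J0 e01 u01 v01 flip; set q := (p * tperm i (p i))%g.
have pia := flippableN flip.
move: flip => /and5P[/forallP pp /forall_inP ap pii ia _].
have {}pp x : p (p x) = x by apply/eqP.
have qE x : q x = if (x == i) || (x == p i) then x else p x.
  rewrite permM; have [->|xi] := eqVneq x i; first by rewrite tpermR.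
  have [->|xpi] := eqVneq x (p i); first by rewrite pp tpermL.
  rewrite tpermD //; last by rewrite (inj_eq perm_inj) eq_sym.
  by apply: contraNneq xpi => ->; rewrite pp.
pose tau s : {perm label K I J} := perm (inv_inj (swapB_funK (I := I) s pii)).
have tauK s l : tau s (tau s l) = l by rewrite !permE; apply: swapB_funK.
pose pb (b : bool) := if b then p else q.
under eq_bigr => sg _ do rewrite distrC.
under [X in e * X]eq_bigr => sg _ do rewrite addrC.
apply: (@special_bit _ _ _ e (fun s sg => (tau s * sg)%g) (uval u ^~ a)
  (fun sg b y => v [set sg @: E | E : {set label K I J} in mpat I (pb b) y])) => //.
- by move=> s sg sg' /mulgI.
- by move=> sg; apply: cube_avg01 => x.
- move=> s sg; rewrite /uval; congr cube_avg; apply: funext => x; congr u.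
  have tE : tau s @: upat J a x = upat J a x.
    apply: imset_involution => // l; rewrite permE.
    case: l => [[d j]|[[t c]|[t [c d]]]] //=; rewrite !inE //=.
    + have [->|ji] := eqVneq j i; first by rewrite (negbTE ia) andbF.
      by have [->|ji'] := eqVneq j (p i); first by rewrite (negbTE pia) andbF.
    + have [_|ts] := eqVneq t s; last by [].
      by case: c; rewrite ?(negbTE ia) ?(negbTE pia) andbF.
  rewrite -[in RHS]tE -imset_comp; apply: eq_imset => l /=; by rewrite permM.
- move=> s sg b y; congr v.
  have <- : [set tau s @: E | E : {set label K I J} in mpat I (pb b) y] =
      mpat I (pb (y s)) (upd y s b).
    apply: imset_mpat => l; rewrite !permE.
    case: l => [[d j]|[[t c]|[t [c d]]]] //=.
    + have [->|ji] := eqVneq j i.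
        rewrite /= ffunE eqxx /pb; case: b;
          by rewrite ?qE ?eqxx /= ?(negbTE pii) /= ?(negbTE pii) ?eqxx.
      have [->|ji'] := eqVneq j (p i).
        rewrite /= ffunE eqxx /pb; case: b; rewrite ?qE ?eqxx ?orbT /= ?pp.
          by rewrite [i == _]eq_sym (negbTE pii) /= eqxx.
        by rewrite eqxx /= (negbTE pii) eqxx.
      have pjE c : pb c j = p j by case: c; rewrite /= ?qE ?(negbTE ji) ?(negbTE ji').
      rewrite /= !pjE; case: ifP => pj /=.
        by rewrite (negbTE ji) (negbTE ji').
      by rewrite (can2_eq pp pp) (negbTE ji') (inj_eq perm_inj) (negbTE ji).
    have [->|ts] := eqVneq t s; last first.
      by rewrite /= ffunE (negbTE ts); case: (y t).
    rewrite /pb; case: (y s); case: c;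
      rewrite /= ?qE ?eqxx ?orbT /= ?pp ?(negbTE pii) ?eqxx //.
    by rewrite [i == _]eq_sym (negbTE pii).
  rewrite -[RHS]imset_comp; apply: eq_imset => E /=.
  by rewrite -imset_comp; apply: eq_imset => l /=; rewrite permM.
Qed.

(** * The corruption inequality *)

Definition single_mass (R : realType) (K I J : finType)
    (u : {set label K I J} -> R) (v : {set {set label K I J}} -> R)
    (sg : {perm label K I J}) : R :=
  \sum_e mval v sg 1%g * uval u sg [set e].

(** In the matching of [1%g] the edges leaving [upat J a x] are the c_i d_i with [i \in a], so the
    single, triple and full masses collect the patterns with 1, 3 and [#|K|] crossing edges. *)
Definition triple_mass (R : realType) (K I J : finType)
    (u : {set label K I J} -> R) (v : {set {set label K I J}} -> R)
    (sg : {perm label K I J}) : R :=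
  \sum_(h : {set K} | #|h| == 3%N) mval v sg 1%g * uval u sg h.

Definition full_mass (R : realType) (K I J : finType)
    (u : {set label K I J} -> R) (v : {set {set label K I J}} -> R)
    (sg : {perm label K I J}) : R :=
  mval v sg 1%g * uval u sg [set: K].

(** One common value for the bound [D] of the local lemmas, at a given embedding [sg]. *)
Definition flip_error (R : realType) (K I J : finType)
    (u : {set label K I J} -> R) (v : {set {set label K I J}} -> R)
    (sg : {perm label K I J}) : R :=
  \sum_(t : {perm K} * {set K} * K | flippable t.1.1 t.1.2 t.2)
    (mval v sg t.1.1 * `|uval u sg t.1.2 - uval u sg (t.2 |: (t.1.1 t.2 |: t.1.2))|
     + uval u sg t.1.2 *
       `|mval v sg t.1.1 - mval v sg (t.1.1 * tperm t.2 (t.1.1 t.2))%g|).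

Lemma uval01 (R : realType) (K I J : finType) (u : {set label K I J} -> R) sg a :
  (forall X, 0 <= u X <= 1) -> 0 <= uval u sg a <= 1.
Proof. by move=> u01; apply: cube_avg01. Qed.

Lemma mval01 (R : realType) (K I J : finType)
    (v : {set {set label K I J}} -> R) sg p :
  (forall X, 0 <= v X <= 1) -> 0 <= mval v sg p <= 1.
Proof. by move=> v01; apply: cube_avg01. Qed.

Lemma flip_error_ge (R : realType) (K I J : finType)
    (u : {set label K I J} -> R) (v : {set {set label K I J}} -> R) sg p a i :
  (forall X, 0 <= u X <= 1) -> (forall X, 0 <= v X <= 1) -> flippable p a i ->
  mval v sg p * `|uval u sg a - uval u sg (i |: (p i |: a))|
    <= flip_error u v sg /\
  uval u sg a * `|mval v sg p - mval v sg (p * tperm i (p i))%g|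
    <= flip_error u v sg.
Proof.
move=> u01 v01 flip.
have f0 q : 0 <= mval v sg q by have /andP[] := mval01 sg q v01.
have g0 b : 0 <= uval u sg b by have /andP[] := uval01 sg b u01.
rewrite /flip_error (bigD1 (p, a, i)) //=; set s := \sum_(t | _) _.
have s0 : 0 <= s by apply: sumr_ge0 => t _; rewrite addr_ge0 1?mulr_ge0.
have h1 := mulr_ge0 (f0 p) (normr_ge0 (uval u sg a - uval u sg (i |: (p i |: a)))).
have h2 := mulr_ge0 (g0 a)
  (normr_ge0 (mval v sg p - mval v sg (p * tperm i (p i))%g)).
by split; lra.
Qed.

(** Up to a tiny term, a flip costs on average [e] times the masses of its patterns. By [local_mass]
    these are bounded by the single and triple masses plus [flip_error] itself, which can be
    absorbed when [e] is small. *)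
Lemma flip_error_sum (R : realType) (K I J : finType) (e : R)
    (u : {set label K I J} -> R) (v : {set {set label K I J}} -> R) :
  (0 < #|I|)%N -> (0 < #|J|)%N -> 0 <= e <= 1 ->
  (forall X, 0 <= u X <= 1) -> (forall X, 0 <= v X <= 1) ->
  \sum_sg flip_error u v sg <=
  #|{: {perm K} * {set K} * K}|%:R *
  (e * \sum_sg (4 * (single_mass u v sg + triple_mass u v sg)
                + (8 * #|K|.+1%:R + 2) * flip_error u v sg)
   + #|{perm label K I J}|%:R *
     (4 * expR (- (e ^+ 2 / 8 * (minn #|I| #|J|)%:R)))).
Proof.
move=> I0 J0 e01 u01 v01; have /andP[e0 e1] := e01.
have f0 sg p : 0 <= mval v sg p by have /andP[] := mval01 sg p v01.
have g0 sg a : 0 <= uval u sg a by have /andP[] := uval01 sg a u01.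
have D0 sg : 0 <= flip_error u v sg.
  by apply: sumr_ge0 => t _; rewrite addr_ge0 1?mulr_ge0.
have hU sg p a i ft := (@flip_error_ge _ _ _ _ u v sg p a i u01 v01 ft).1.
have hM sg p a i ft := (@flip_error_ge _ _ _ _ u v sg p a i u01 v01 ft).2.
pose Y sg := single_mass u v sg + triple_mass u v sg
               + #|K|.+1%:R * flip_error u v sg *+ 2.
have mass sg p a i : flippable p a i -> mval v sg p * uval u sg a <= Y sg.
  by move=> ft; apply: (local_mass (i := i)) => //; [apply: hU|apply: hM].
pose tiny (m : nat) : R := 2 * expR (- (e ^+ 2 / 8 * m%:R)).
have tinyI m m' : (m <= m')%N -> tiny m' <= tiny m.
  move=> mm'; rewrite /tiny ler_wpM2l // ler_expR lerN2 ler_wpM2l ?ler_nat //.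
  by rewrite divr_ge0 ?sqr_ge0.
set P : R := #|{perm label K I J}|%:R.
rewrite {1}/flip_error exchange_big /=.
apply: (@le_trans _ _ (\sum_(t : {perm K} * {set K} * K)
  (e * \sum_sg (4 * Y sg + 2 * flip_error u v sg)
   + P * (2 * tiny (minn #|I| #|J|))))); last first.
  rewrite sumr_const -[leLHS]mulr_natl ler_wpM2l ?ler0n //; apply: lerD.
    rewrite ler_wpM2l //; apply: ler_sum => sg _; rewrite /Y mulr2n -mulr_natr; lra.
  by rewrite /tiny; lra.
rewrite [leRHS](bigID (fun t => flippable t.1.1 t.1.2 t.2)) /=.
rewrite -[leLHS]addr0 lerD //; last first.
  apply: sumr_ge0 => t _; rewrite addr_ge0 //.
    rewrite mulr_ge0 //; apply: sumr_ge0 => sg _; rewrite addr_ge0 1?mulr_ge0 //.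
    rewrite addr_ge0 ?addr_ge0 ?mulrn_wge0 1?mulr_ge0 //.
    - by apply: sumr_ge0 => ? _; rewrite mulr_ge0.
    - by apply: sumr_ge0 => ? _; rewrite mulr_ge0.
  by rewrite !mulr_ge0 ?expR_ge0 ?ler0n.
apply: ler_sum => -[[p a] i] /= ft; rewrite big_split /=.
have h1 := flip_set_sum I0 e01 u01 v01 ft.
have h2 := flip_perm_sum J0 e01 u01 v01 ft.
apply: le_trans (lerD h1 h2) _; rewrite -/P.
have -> : forall a b c d : R,
    e * a + P * b + (e * c + P * d) = e * (a + c) + P * (b + d).
  by move=> *; ring.
apply: lerD.
  rewrite ler_wpM2l // -big_split /=; apply: ler_sum => sg _.
  have m1 := mass sg _ _ _ ft; have m2 := hU sg _ _ _ ft; have m3 := hM sg _ _ _ ft.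
  set p' := (p * _)%g in m3 *; set a' := i |: _ in m2 *.
  have m4 : mval v sg p * uval u sg a' <= mval v sg p * uval u sg a + flip_error u v sg.
    rewrite -lerBlDl -mulrBr; apply: le_trans m2; rewrite ler_wpM2l //.
    by rewrite distrC ler_norm.
  have m5 : uval u sg a * mval v sg p' <= uval u sg a * mval v sg p + flip_error u v sg.
    rewrite -lerBlDl -mulrBr; apply: le_trans m3; rewrite ler_wpM2l //.
    by rewrite distrC ler_norm.
  lra.
rewrite ler_wpM2l ?ler0n // [2 * tiny _]mulr_natl mulr2n; apply: lerD.
  by apply: tinyI; rewrite geq_minl.
by apply: tinyI; rewrite geq_minr.
Qed.

(** Summed over [sg], [local_triples] has [flip_error] as error term, and [flip_error_sum] bounds it
    by a small multiple of the masses. The shares of [flip_error] and [triple_mass] on the right are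
    absorbed on the left. *)
Lemma corruption (R : realType) (K : finType) (d : R) :
  odd #|K| -> (5 <= #|K|)%N -> 0 < d <= 1 ->
  exists c M : R, 0 < c /\ 0 < M /\ forall (I J : finType)
    (u : {set label K I J} -> R) (v : {set {set label K I J}} -> R),
  (0 < #|I|)%N -> (0 < #|J|)%N ->
  (forall X, 0 <= u X <= 1) -> (forall X, 0 <= v X <= 1) ->
  \sum_sg triple_mass u v sg <=
    4 * #|K|%:R * \sum_sg full_mass u v sg
    + (1 + d) * 'C(#|K|.-1, 2)%:R * \sum_sg single_mass u v sg
    + #|{perm label K I J}|%:R * (M * expR (- (c * (minn #|I| #|J|)%:R))).
Proof.
move=> oK K5 /andP[d0 d1].
pose t := d / 64.
have t08 : 0 < t <= 8^-1 by rewrite /t; apply/andP; split; lra.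
pose Q : R := 'C(#|K|, 3)%:R * ((2 / t + 3) * #|K|.+1%:R).
have Q0 : 0 <= Q.
  have : 0 < t^-1 by rewrite invr_gt0; case/andP: t08.
  by move=> ?; rewrite !mulr_ge0 ?ler0n //; lra.
set Nf : R := #|{: {perm K} * {set K} * K}|%:R.
have Nf0 : 0 <= Nf by rewrite ler0n.
pose k1 : R := #|K|.+1%:R.
have k11 : 1 <= k1 by rewrite ler1n.
(* So small that [e] times [Nf], [Nf * k1] or [Nf * Q] is at most [d / 64]. *)
pose e := d / (64 * (Nf + 1) * (Q + 1) * (k1 + 1)).
have den0 : 0 < 64 * (Nf + 1) * (Q + 1) * (k1 + 1).
  by rewrite !mulr_gt0 //; lra.
have e0 : 0 < e by rewrite divr_gt0.
have eN : e * (64 * (Nf + 1) * (Q + 1) * (k1 + 1)) = d.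
  by rewrite /e divfK // gt_eqF.
have NfQ : 0 <= Nf * Q by rewrite mulr_ge0.
have bnd x : 0 <= x <= (Nf + 1) * (Q + 1) * (k1 + 1) -> 64 * (e * x) <= d.
  by move=> /andP[x0 xle]; rewrite -eN mulrCA ler_pM2l // -!mulrA ler_pM2l // mulrA.
have NfQk : 0 <= Nf * Q * k1 by rewrite mulr_ge0 //; lra.
have Nfk : 0 <= Nf * k1 by rewrite mulr_ge0 //; lra.
have Qk : 0 <= Q * k1 by rewrite mulr_ge0 //; lra.
have e1 : e <= 1.
  have : 64 * (e * 1) <= d by apply: bnd; apply/andP; split; lra.
  lra.
have e2 : 64 * (e * (Nf * k1)) <= d by apply: bnd; apply/andP; split; lra.
have e3 : 64 * (e * (Nf * Q)) <= d by apply: bnd; apply/andP; split; lra.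
have e4 : 64 * (e * Nf) <= d by apply: bnd; apply/andP; split; lra.
exists (e ^+ 2 / 8), (16 * Nf * Q + 1); split; first by rewrite divr_gt0 ?exprn_gt0.
split; first by lra.
move=> I J u v I0 J0 u01 v01.
have e01 : 0 <= e <= 1 by rewrite ltW.
have f0 sg p : 0 <= mval v sg p by have /andP[] := mval01 sg p v01.
have g0 sg a : 0 <= uval u sg a by have /andP[] := uval01 sg a u01.
have := flip_error_sum I0 J0 e01 u01 v01.
rewrite -/Nf -/k1 big_split /= -!mulr_sumr big_split /=.
set P : R := #|{perm label K I J}|%:R; set T := expR _.
set SD := \sum_sg flip_error u v sg; set S1 := \sum_sg single_mass u v sg.
set S3 := \sum_sg triple_mass u v sg; set SF := \sum_sg full_mass u v sg.
have T0 : 0 <= P * T by rewrite mulr_ge0 ?expR_ge0 ?ler0n.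
have err0 sg : 0 <= flip_error u v sg.
  by apply: sumr_ge0 => x _; rewrite addr_ge0 1?mulr_ge0.
have SD0 : 0 <= SD by apply: sumr_ge0.
have S10 : 0 <= S1 by do 2!(apply: sumr_ge0 => ? _); rewrite mulr_ge0.
have S30 : 0 <= S3 by do 2!(apply: sumr_ge0 => ? _); rewrite mulr_ge0.
have SF0 : 0 <= SF by apply: sumr_ge0 => ? _; rewrite mulr_ge0.
move=> hD.
(* On the right of [hD], [SD] has total coefficient at most one half. *)
have hD2 : SD <= 8 * (e * Nf) * (S1 + S3) + 8 * Nf * (P * T).
  have : 0 <= (1 - 2 * (e * (Nf * (8 * k1 + 2)))) * SD.
    by rewrite mulr_ge0 //; lra.
  lra.
pose C2 : R := 'C(#|K|.-1, 2)%:R.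
have C21 : 1 <= C2 by rewrite ler1n bin_gt0; case: #|K| K5 => [|[|[|]]].
have hloc : S3 <= #|K|%:R * 2 * SF + C2 * (1 + 8 * t) * S1 + Q * SD.
  rewrite /S3 /SF /S1 /SD !mulr_sumr -!big_split /=; apply: ler_sum => sg _.
  have hU p a i ft := (@flip_error_ge _ _ _ _ u v sg p a i u01 v01 ft).1.
  have hM p a i ft := (@flip_error_ge _ _ _ _ u v sg p a i u01 v01 ft).2.
  apply: le_trans (local_triples oK K5 t08 (f0 sg) (g0 sg) (err0 sg) hU (hM)) _.
  by rewrite /Q /full_mass /single_mass !mulrA.
(* The share of the masses that returns through the error term; [eta <= d / 8] lets it be
   absorbed. *)
pose eta := 8 * (e * (Nf * Q)).
have eta0 : 0 <= eta by rewrite /eta mulr_ge0 // mulr_ge0 // ltW.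
have etad : eta <= d / 8 by rewrite /eta; lra.
have hQ : Q * SD <= eta * (S1 + S3) + 8 * Nf * Q * (P * T).
  have := ler_wpM2l Q0 hD2; rewrite /eta; lra.
have h : (1 - eta) * S3 <= #|K|%:R * 2 * SF + (C2 * (1 + 8 * t) + eta) * S1
     + 8 * Nf * Q * (P * T) by lra.
have eta1 : 0 < 1 - eta by lra.
rewrite -(ler_pM2l eta1); apply: le_trans h _.
have k0 : 0 <= #|K|%:R * SF by rewrite mulr_ge0 ?ler0n.
have a1 : eta * (#|K|%:R * SF) <= 8^-1 * (#|K|%:R * SF) by rewrite ler_wpM2r //; lra.
have N0 : 0 <= Nf * Q * (P * T) by rewrite mulr_ge0.
have a2 : eta * (Nf * Q * (P * T)) <= 8^-1 * (Nf * Q * (P * T)).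
  by rewrite ler_wpM2r //; lra.
have a3 : eta * (P * T) <= 8^-1 * (P * T) by rewrite ler_wpM2r //; lra.
have a4 : (C2 * (1 + 8 * t) + eta) * S1 <= (1 - eta) * ((1 + d) * C2) * S1.
  rewrite ler_wpM2r //.
  have b1 : 0 <= (C2 - 1) * d by rewrite mulr_ge0 ?subr_ge0 // ltW.
  apply: (@le_trans _ _ (C2 * (1 + 8 * t + d / 8))); first by lra.
  rewrite [leRHS]mulrA [leRHS]mulrC ler_wpM2l ?ler0n //.
  have b2 : eta * (1 + d) <= d / 8 * 2.
    by apply: ler_pM => //; lra.
  rewrite /t; lra.
lra.
Qed.

(** * Lower bound on the size of LP formulations *)

Lemma mateK (K I J : finType) (y : {ffun J -> bool}) :
  involutive (@mate K I J 1%g y).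
Proof.
move=> [[d i]|[[j b]|[j [b d]]]] /=.
- by rewrite perm1 eqxx /= perm1 eqxx negbK.
- by rewrite negbK.
- by case: (y j); rewrite /= negbK.
Qed.

Lemma mate_neq (K I J : finType) (y : {ffun J -> bool}) (l : label K I J) :
  mate 1%g y l != l.
Proof.
case: l => [[d i]|[[j b]|[j [b d]]]] /=; apply/eqP; rewrite ?perm1 ?eqxx.
- by case=> /eqP; case: d.
- by case=> /eqP; case: b.
- by case: (y j) => -[] /eqP; [case: b | case: d].
Qed.

(** The partner of c_i is d_i, which is never in the set, so only the selected pairs are matched
    inside it, whatever [a] is. *)
Lemma upat_mate (K I J : finType) (a : {set K}) (x : {ffun I -> bool})
    (y : {ffun J -> bool}) (l : label K I J) :
  (l \in upat J a x) && (mate 1%g y l \in upat J a x) = (l \in upat J finset.set0 x).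
Proof.
case: l => [[d i]|[[j b]|[j [b d]]]]; rewrite !inE /= ?perm1 ?eqxx /=.
- by case: d; rewrite /= ?andbF ?inE.
- by rewrite andbb.
- by [].
Qed.

Lemma card_upat (K I J : finType) (a : {set K}) (x : {ffun I -> bool}) :
  #|upat J a x| = (#|a| + #|upat J (finset.set0 : {set K}) x|)%N.
Proof.
pose C (i : K) : label K I J := inl (false, i).
have CI : injective C by move=> i j [].
have -> : upat J a x = C @: a :|: upat J finset.set0 x.
  apply/setP => l; rewrite inE; case: l => [[d i]|[[j b]|[j [b d]]]].
  - rewrite !inE; case: d => /=.
      by rewrite orbF; apply/esym/imsetP => -[].
    by rewrite orbF -[inl (false, i)]/(C i) mem_imset.
  - rewrite !inE /=; case: imsetP => [[]|] //.
  - rewrite !inE /=; case: imsetP => [[]|] //.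
rewrite cardsU card_imset //.
have -> : C @: a :&: upat J finset.set0 x = finset.set0.
  apply/setP => l; rewrite !inE; apply/negP => /andP[/imsetP[i _ ->]] /=.
  by rewrite inE.
by rewrite cards0 subn0.
Qed.

Lemma mpat_perfect (K I J : finType) (n : nat) (h : label K I J -> 'I_n)
    (y : {ffun J -> bool}) :
  bijective h ->
  is_perfect_matching [set h @: e | e : {set label K I J} in mpat I 1%g y].
Proof.
move=> hB; have hI := bij_inj hB.
have memE e : e \in [set h @: e | e : {set label K I J} in mpat I 1%g y] ->
    exists l, e = [set h l; h (mate 1%g y l)].
  move=> /imsetP[_ /imsetP[l _ ->] ->]; exists l.
  by rewrite imsetU !imset_set1.
have uniqE l z : z \in [set h l; h (mate 1%g y l)] ->
    exists2 l', z = h l' & [set h l; h (mate 1%g y l)] = [set h l'; h (mate 1%g y l')].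
  rewrite !inE => /orP[]/eqP->; first by exists l.
  by exists (mate 1%g y l) => //; rewrite mateK setUC.
apply/andP; split; first (apply/andP; split).
- apply/subsetP => e /memE[l ->]; rewrite inE subsetT cards2 /=.
  by rewrite (inj_eq hI) [l == _]eq_sym mate_neq.
- apply/trivIsetP => e e' /memE[l ->] /memE[l' ->] ne.
  rewrite -setI_eq0; apply: contraNT ne => /set0Pn[z].
  rewrite inE => /andP[/uniqE[m -> ->] /uniqE[m' + ->]].
  by move/hI ->.
- apply/eqP/setP => z; rewrite inE; have [g _ hg] := hB.
  apply/bigcupP; exists (h @: [set g z; mate 1%g y (g z)]).
    by apply: imset_f; apply: imset_f.
  by rewrite -{1}[z]hg imset_f // !inE eqxx.
Qed.

Lemma card_edges_pattern (K I J : finType) (n : nat) (h : label K I J -> 'I_n)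
    (a : {set K}) (x : {ffun I -> bool}) (y : {ffun J -> bool}) :
  bijective h ->
  (#|edges_in (h @: upat J a x) :&:
     [set h @: e | e : {set label K I J} in mpat I 1%g y]| * 2 =
   #|upat J (finset.set0 : {set K}) x|)%N.
Proof.
move=> hB; have hI := bij_inj hB.
pose M := [set h @: e | e : {set label K I J} in mpat I 1%g y].
set U := h @: upat J a x; rewrite -/M.
have /andP[/andP[ME tM] _] := mpat_perfect y hB.
rewrite -/M in ME tM.
have tUM : trivIset (edges_in U :&: M).
  apply/trivIsetP => E E' /setIP[_ EM] /setIP[_ E'M].
  by move/trivIsetP : tM; apply.
have -> : (#|edges_in U :&: M| * 2)%N = #|cover (edges_in U :&: M)|.
  rewrite -(eqP tUM) -sum_nat_const; apply: eq_bigr => e.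
  by rewrite !inE => /andP[/andP[_ /eqP]].
rewrite -(card_imset _ hI); congr #|pred_of_set _|; apply/setP => z.
apply/bigcupP/imsetP.
  move=> [e]; rewrite inE => /andP[]; rewrite inE => /andP[eU _].
  move=> /imsetP[_ /imsetP[l _ ->] eE]; rewrite eE imsetU !imset_set1 in eU *.
  move: eU; rewrite subUset !sub1set !mem_imset // => lU.
  have mU : (l \in upat J finset.set0 x) && (mate 1%g y l \in upat J finset.set0 x).
    rewrite -!(upat_mate a x y) mateK; case/andP: lU => -> ->; by [].
  case/andP: mU => l0 m0.
  by rewrite !inE => /orP[]/eqP ->; [exists l | exists (mate 1%g y l)].
move=> [l l0 ->]; exists (h @: [set l; mate 1%g y l]); last first.
  by apply: imset_f; rewrite !inE eqxx.
have lU := l0; rewrite -(upat_mate a x y) in lU; case/andP: lU => lU mU.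
rewrite inE; apply/andP; split; last by apply: imset_f; apply: imset_f.
rewrite inE; apply/andP; split; last first.
  by rewrite imsetU !imset_set1 cards2 (inj_eq hI) [l == _]eq_sym mate_neq.
by apply: imsetS; rewrite subUset !sub1set lU.
Qed.

Lemma cube_avgZ (R : realType) (I : finType) (c : R) (F : {ffun I -> bool} -> R) :
  cube_avg (fun x => c * F x) = c * cube_avg F.
Proof. by rewrite /cube_avg -mulr_sumr mulrCA. Qed.

(* Rescaling [u] by its maximum reduces this to the case of values in [0, 1]. *)
Lemma corruption_scaled (R : realType) (K : finType) (d : R) :
  odd #|K| -> (5 <= #|K|)%N -> 0 < d <= 1 ->
  exists c M : R, 0 < c /\ 0 < M /\ forall (I J : finType) (B : R)
    (u : {set label K I J} -> R) (v : {set {set label K I J}} -> R),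
  (0 < #|I|)%N -> (0 < #|J|)%N -> 0 < B ->
  (forall X, 0 <= u X) -> (forall X, 0 <= v X) ->
  (forall X Y, u X * v Y <= B) ->
  \sum_sg triple_mass u v sg <=
    4 * #|K|%:R * \sum_sg full_mass u v sg
    + (1 + d) * 'C(#|K|.-1, 2)%:R * \sum_sg single_mass u v sg
    + B * (#|{perm label K I J}|%:R * (M * expR (- (c * (minn #|I| #|J|)%:R)))).
Proof.
move=> oK K5 d01; have [c [M [c0 [M0 cor]]]] := corruption oK K5 d01.
exists c, M; split=> //; split=> // I J B u v I0 J0 B0 u0 v0 uvB.
have [X0 _ Xmax] := @arg_maxP _ R _ finset.set0 predT u isT.
set m := u X0 in Xmax.
have {}Xmax X : u X <= m by apply: Xmax.
have m0 : 0 <= m by apply: u0.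
have tiny0 : 0 <= #|{perm label K I J}|%:R * (M * expR (- (c * (minn #|I| #|J|)%:R))).
  by rewrite mulr_ge0 // mulr_ge0 ?expR_ge0 // ltW.
have [mE|mN] := eqVneq m 0.
  have uE X : u X = 0 by apply/eqP; rewrite eq_le u0 andbT -mE Xmax.
  have uvalE sg a : uval u sg a = 0.
    by rewrite /uval /cube_avg big1 ?mulr0 // => x _; rewrite uE.
  rewrite [leLHS]big1 => [|sg _]; last first.
    by rewrite /triple_mass big1 // => h _; rewrite uvalE mulr0.
  rewrite [X in _ * X + _ + _]big1 => [|sg _]; last by rewrite /full_mass uvalE mulr0.
  rewrite [X in _ + _ * X + _]big1 => [|sg _]; last first.
    by rewrite /single_mass big1 // => h _; rewrite uvalE mulr0.
  by rewrite !mulr0 !add0r mulr_ge0 // ltW.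
have mp : 0 < m by rewrite lt_neqAle eq_sym mN.
(* [v] is scaled by [m / B], which bounds it by 1 because [u X0 * v Y <= B] at the maximizer
   [X0]. *)
pose u' X := m^-1 * u X; pose v' Y := (m / B) * v Y.
have u01 X : 0 <= u' X <= 1.
  rewrite /u' mulr_ge0 ?invr_ge0 //= mulrC ler_pdivrMr // mul1r; exact: Xmax.
have v01 Y : 0 <= v' Y <= 1.
  rewrite /v' mulr_ge0 ?divr_ge0 ?(ltW B0) //= mulrAC ler_pdivrMr // mul1r; exact: uvB.
have uvE sg p a : mval v' sg p * uval u' sg a = B^-1 * (mval v sg p * uval u sg a).
  by rewrite /mval /uval !cube_avgZ; field; rewrite mN gt_eqF.
have := cor I J u' v' I0 J0 u01 v01.
have -> : \sum_sg triple_mass u' v' sg = B^-1 * \sum_sg triple_mass u v sg.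
  rewrite mulr_sumr; apply: eq_bigr => sg _; rewrite /triple_mass mulr_sumr.
  by apply: eq_bigr => h _.
have -> : \sum_sg full_mass u' v' sg = B^-1 * \sum_sg full_mass u v sg.
  by rewrite mulr_sumr; apply: eq_bigr => sg _; rewrite /full_mass.
have -> : \sum_sg single_mass u' v' sg = B^-1 * \sum_sg single_mass u v sg.
  rewrite mulr_sumr; apply: eq_bigr => sg _; rewrite /single_mass mulr_sumr.
  by apply: eq_bigr => h _.
move=> h; have := ler_wpM2l (ltW B0) h.
rewrite [leLHS]mulrA mulfV ?gt_eqF // mul1r => /le_trans; apply.
by rewrite le_eqVlt; apply/orP; left; apply/eqP; field; rewrite gt_eqF.
Qed.

(** One half of Yannakakis' theorem: Farkas' lemma writes each slack as a nonnegative combination of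
    the slacks of the inequalities at [lp_pt], plus a constant. The extra index [ord_max] carries
    the constant. *)
Lemma lp_slack_factorization (R : realType) (P : approx_problem R) (m : nat)
    (L : lp_formulation P m) (s0 : sol P) :
  exists (al : obj P -> 'I_m.+1 -> R) (be : sol P -> 'I_m.+1 -> R),
  [/\ forall f i, 0 <= al f i, forall s i, 0 <= be s i &
    forall f s, guarantee f - objv f s = \sum_i al f i * be s i].
Proof.
have hf (f : obj P) : exists l : ('I_m -> R) * R,
    [/\ forall i, 0 <= l.1 i, 0 <= l.2 & forall x : 'cV[R]_(lp_dim L),
      guarantee f - lp_c L f - (lp_w L f *m x) 0 0 =
      l.2 + \sum_i l.1 i * (lp_rhs L i 0 - (lp_mx L *m x) i 0)].
  have [||l [l0 [h1 h2 h3]]] := @affine_farkas R (lp_dim L) m (lp_mx L)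
      (lp_rhs L) (lp_w L f) (guarantee f - lp_c L f).
  - by exists (lp_pt L s0); apply: lp_pt_feasible.
  - move=> x hx; have := @lp_obj_le _ _ _ L f x hx.
    by rewrite /lp_obj lerBrDr.
  - exists (l, l0); split=> /=; [exact: h1|exact: h2|exact: h3].
have [l hl] := choice hf.
exists (fun f i => if unlift ord_max i is Some j then (l f).1 j else (l f).2),
  (fun s i => if unlift ord_max i is Some j
    then lp_rhs L j 0 - (lp_mx L *m lp_pt L s) j 0 else 1).
split=> [f i|s i|f s].
- by case: unliftP => [j _|_]; case: (hl f).
- case: unliftP => [j _|_] //; rewrite subr_ge0.
  exact: lp_pt_feasible.
- rewrite -(lp_obj_exact L) /lp_obj big_ord_recr /= unlift_none mulr1.
  have [_ _ /(_ (lp_pt L s)) hx] := hl f.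
  rewrite [_ + lp_c L f]addrC opprD addrA hx addrC; congr (_ + _).
  apply: eq_bigr => i _.
  by rewrite widen_ord_lift_max liftK.
Qed.

Lemma cube_avg_const (R : realType) (I : finType) (s : R) :
  @cube_avg R I (fun=> s) = s.
Proof.
by rewrite /cube_avg sumr_const card_ffun card_bool -[s *+ _]mulr_natl natrX mulKf.
Qed.

Lemma cube_avg_pair (R : realType) (T I J : finType)
    (F : T -> {ffun J -> bool} -> R) (G : T -> {ffun I -> bool} -> R) (s : R) :
  (forall x y, \sum_t F t y * G t x = s) ->
  \sum_t cube_avg (F t) * cube_avg (G t) = s.
Proof.
move=> FG; rewrite -[RHS](@cube_avg_const R I) /cube_avg.
under eq_bigr => t _ do rewrite mulrCA.
rewrite -mulr_sumr; congr (_ * _).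
under eq_bigr => t _ do rewrite mulr_sumr.
rewrite exchange_big /=; apply: eq_bigr => x _.
rewrite -[RHS](@cube_avg_const R J) /cube_avg.
under eq_bigr => t _ do rewrite -mulrA.
rewrite -mulr_sumr; congr (_ * _).
under eq_bigr => t _ do rewrite mulr_suml.
by rewrite exchange_big /=; apply: eq_bigr => y _.
Qed.

(** If [E] edges lie inside the set, it has [#|a| + E * 2] vertices, so the slack depends on [#|a|]
    only. *)
Lemma pattern_slack (R : realType) (K I J : finType) (n : nat) (eps : R)
    (h : label K I J -> 'I_n) (a : {set K}) (x : {ffun I -> bool})
    (y : {ffun J -> bool}) :
  bijective h -> odd #|a| ->
  odd #|h @: upat J a x| /\
  (#|h @: upat J a x|%:R - 1 + eps) / 2 - #|edges_in (h @: upat J a x) :&: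
     [set h @: e | e : {set label K I J} in mpat I 1%g y]|%:R =
  (#|a|%:R - 1 + eps) / 2.
Proof.
move=> hB oa; have := card_edges_pattern a x y hB.
set E := #|edges_in _ :&: _| => cE.
have cU : #|h @: upat J a x| = (#|a| + E * 2)%N.
  by rewrite card_imset; [rewrite card_upat cE | exact: bij_inj].
rewrite cU; split; first by rewrite oddD oa muln2 odd_double.
rewrite natrD natrM; lra.
Qed.

(** The slack factorization is pulled back along a bijection from the labels to ['I_n]. Every
    product [u t X * v t Y] is zero or at most a slack, which gives the bound [n%:R]. *)
Lemma MatchStar_factorization (R : realType) (K I J : finType) (n r : nat) (eps : R) :
  #|label K I J| = n -> (0 < n)%N -> 0 < eps < 1 ->
  lp_formulation (MatchStar n eps) r ->
  exists (u : 'I_r.+1 -> {set label K I J} -> R)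
         (v : 'I_r.+1 -> {set {set label K I J}} -> R),
  [/\ forall t X, 0 <= u t X, forall t Y, 0 <= v t Y,
      forall t X Y, u t X * v t Y <= n%:R &
      forall sg (a : {set K}), odd #|a| ->
        \sum_t mval (v t) sg 1%g * uval (u t) sg a = (#|a|%:R - 1 + eps) / 2].
Proof.
move=> cL n_gt0 /andP[eps0 eps1] L.
pose h0 (l : label K I J) : 'I_n := cast_ord cL (enum_rank l).
have h0B : bijective h0.
  exists (fun z => enum_val (cast_ord (esym cL) z)) => z.
    by rewrite /h0 cast_ordK enum_rankK.
  by rewrite /h0 enum_valK cast_ordKV.
have hB (sg : {perm label K I J}) : bijective (h0 \o sg).
  by apply: bij_comp => //; exists (sg^-1)%g => z; rewrite ?permK ?permKV.
have sM : sol (MatchStar n eps).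
  pose h1 := h0 \o (1%g : {perm label K I J}).
  by exists [set h1 @: e | e : {set label K I J} in mpat I 1%g [ffun=> true]];
    apply: mpat_perfect; apply: hB.
have [al [be [al0 be0 slack]]] := lp_slack_factorization L sM.
(* The value is 0 at sets of even size; likewise [v] below is 0 off the perfect matchings. *)
pose u (t : 'I_r.+1) (X : {set label K I J}) : R :=
  if insub (h0 @: X) : option (odd_subset n) is Some U then al U t else 0.
pose v (t : 'I_r.+1) (Y : {set {set label K I J}}) : R :=
  if insub [set h0 @: e | e : {set label K I J} in Y] : option (perfect_matching n)
    is Some m then be m t else 0.
have n0 : 0 < n%:R :> R by rewrite ltr0n.
exists u, v.
have u0 t X : 0 <= u t X by rewrite /u; case: insubP.
have v0 t X : 0 <= v t X by rewrite /v; case: insubP.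
split=> // [t X Y|sg a oa].
  rewrite /u /v; case: insubP => [U _ _|_]; last by rewrite mul0r ltW.
  case: insubP => [m _ _|_]; last by rewrite mulr0 ltW.
  have le_slack : al U t * be m t <= (#|val U|%:R - 1 + eps) / 2
      - #|edges_in (val U) :&: val m|%:R.
    have /= -> := slack U m.
    by rewrite (bigD1 t) //= lerDl sumr_ge0 // => t' _; exact: mulr_ge0.
  apply: le_trans le_slack _.
  have : (#|val U| <= n)%N by rewrite -[leqRHS]card_ord max_card.
  rewrite -(ler_nat R) => hU; apply: (@le_trans _ _ ((n%:R - 1 + eps) / 2)).
    apply: (@le_trans _ _ ((#|val U|%:R - 1 + eps) / 2)).
      by rewrite lerBlDr lerDl ler0n.
    by rewrite ler_pM2r // lerD2r lerD2r.
  lra.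
apply: cube_avg_pair => x y.
have E1 : h0 @: (sg @: upat J a x) = (h0 \o sg) @: upat J a x.
  by rewrite -imset_comp.
have E2 : [set h0 @: e | e : {set label K I J} in
    [set sg @: e | e : {set label K I J} in mpat I 1%g y]] =
    [set (h0 \o sg) @: e | e : {set label K I J} in mpat I 1%g y].
  by rewrite -imset_comp; apply: eq_imset => e; rewrite /= -imset_comp.
have [oU sE] := pattern_slack eps x y (hB sg) oa.
have pM := mpat_perfect y (hB sg).
rewrite /u /v E1 E2 (insubT (fun U : {set 'I_n} => odd #|U|) oU).
rewrite (insubT (@is_perfect_matching n) pM) /= -sE.
under eq_bigr => t _ do rewrite mulrC.
by rewrite -slack.
Qed.

(** Summing [corruption_scaled] over the [r.+1] terms gives [C3 * ((2 + eps) / 2)] on the left, and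
    on the right [(1 + d) * (C3 * 3) * (eps / 2)] plus a term quadratic in [k] and an exponentially
    small one. As [eps < 1] and [k] is large, a small [r] would be contradictory. *)
Lemma MatchStar_size_lower (R : realType) (eps : R) : 0 < eps < 1 ->
  exists (k : nat) (c M : R), [/\ 0 < c, 0 < M & forall i j r : nat,
    (0 < i)%N -> (0 < j)%N ->
    lp_formulation (MatchStar (k * 2 + i * 2 + j * 4) eps) r ->
    expR (c * (minn i j)%:R) <= M * (k * 2 + i * 2 + j * 4)%:R * r.+1%:R].
Proof.
move=> /andP[eps0 eps1].
(* Odd, at least 5, and so large that the quadratic term is small against [(1 - eps) * C3]. *)
pose k := (Num.bound (144 / (1 - eps)) * 2 + 5)%N.
have k5 : (5 <= k)%N by rewrite leq_addl.
have kb : 144 / (1 - eps) <= k%:R.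
  apply: (@le_trans _ _ (Num.bound (144 / (1 - eps)))%:R).
    by rewrite ltW // archi_boundP // divr_ge0 // subr_ge0 ltW.
  by rewrite ler_nat /k; lia.
pose K : finType := 'I_k.
have cK : #|K| = k by rewrite card_ord.
have oK : odd #|K| by rewrite cK /k oddD oddM andbF.
pose d : R := (1 - eps) / 6.
have d01 : 0 < d <= 1 by rewrite /d; apply/andP; split; lra.
have K5 : (5 <= #|K|)%N by rewrite cK.
have [c [M [c0 [M0 cor]]]] := @corruption_scaled R K d oK K5 d01.
rewrite cK in cor.
pose C3 : R := 'C(k, 3)%:R.
have C30 : 0 < C3 by rewrite ltr0n bin_gt0 (leq_trans _ k5).
exists k, c, (2 * M / ((1 - eps) * C3)); split=> //.
  by rewrite divr_gt0 ?mulr_gt0 // subr_gt0.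
move=> i j r i0 j0; set n := (k * 2 + i * 2 + j * 4)%N => L.
have cL : #|label K 'I_i 'I_j| = n.
  by rewrite !card_sum !card_prod !card_bool cK !card_ord mulnC addnA.
have n_gt0 : (0 < n)%N by rewrite /n -addnA addnCA ltn_addr // muln_gt0 i0.
have n0 : 0 < n%:R :> R by rewrite ltr0n.
have eps01 : 0 < eps < 1 by rewrite eps0.
have [u [v [u0 v0 uv key]]] := MatchStar_factorization cL n_gt0 eps01 L.
move: cL cor => _ cor; clearbody n.
have {}cor := fun t => cor 'I_i 'I_j n%:R (u t) (v t).
rewrite !card_ord in cor; have {}cor t := cor t i0 j0 n0 (u0 t) (v0 t) (uv t).
pose P : R := #|{perm label K 'I_i 'I_j}|%:R.
have P0 : 0 < P by rewrite ltr0n; apply/card_gt0P; exists 1%g.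
have sum3 : \sum_t \sum_sg triple_mass (u t) (v t) sg = P * (C3 * ((2 + eps) / 2)).
  rewrite exchange_big /=.
  have h sg : \sum_t triple_mass (u t) (v t) sg = C3 * ((2 + eps) / 2).
    rewrite exchange_big /=.
    rewrite (eq_bigr (fun=> (2 + eps) / 2)); last first.
      by move=> h /eqP h3; rewrite key h3 //; congr (_ / _); ring.
    rewrite (eq_bigl (fun h => h \in
      [set h : {set K} | (h \subset [set: K]) && (#|h| == 3%N)])).
      by rewrite sumr_const cards_draws cardsT cK mulr_natl.
    by move=> h; rewrite inE subsetT.
  by rewrite (eq_bigr _ (fun sg _ => h sg)) sumr_const /P [RHS]mulr_natl.
have sum1 : \sum_t \sum_sg single_mass (u t) (v t) sg = P * (k%:R * (eps / 2)).
  rewrite exchange_big /=.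
  have h sg : \sum_t single_mass (u t) (v t) sg = k%:R * (eps / 2).
    rewrite exchange_big /= (eq_bigr (fun=> eps / 2)); last first.
      by move=> e _; rewrite key cards1 // subrr add0r.
    by rewrite sumr_const cK mulr_natl.
  by rewrite (eq_bigr _ (fun sg _ => h sg)) sumr_const /P [RHS]mulr_natl.
have sumk : \sum_t \sum_sg full_mass (u t) (v t) sg = P * ((k%:R - 1 + eps) / 2).
  rewrite exchange_big /=.
  have h sg : \sum_t full_mass (u t) (v t) sg = (k%:R - 1 + eps) / 2.
    by rewrite key cardsT cK // -cK.
  by rewrite (eq_bigr _ (fun sg _ => h sg)) sumr_const /P [RHS]mulr_natl.
have total : \sum_t \sum_sg triple_mass (u t) (v t) sg <=
   \sum_(t : 'I_r.+1) (4 * k%:R * \sum_sg full_mass (u t) (v t) sg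
    + (1 + d) * 'C(k.-1, 2)%:R * \sum_sg single_mass (u t) (v t) sg
    + n%:R * (P * (M * expR (- (c * (minn i j)%:R))))).
  apply: ler_sum => t _.
  exact: cor.
move: total; rewrite !big_split /= -!mulr_sumr sum3 sumk sum1 sumr_const card_ord.
rewrite -[_ *+ r.+1]mulr_natl expRN => total.
set T := expR _ in total *; have T0 : 0 < T by apply: expR_gt0.
have C3E : C3 * 3 = k%:R * 'C(k.-1, 2)%:R.
  by rewrite /C3 -!natrM mul_bin_diag mulnC.
have C2E : 'C(k.-1, 2)%:R * 2 = (k%:R - 1) * (k%:R - 2) :> R.
  have -> : k%:R - 1 = k.-1%:R :> R by rewrite -subn1 natrB // (leq_trans _ k5).
  have -> : k%:R - 2 = k.-2%:R :> R by rewrite -subn2 natrB // (leq_trans _ k5).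
  by rewrite -!natrM mulnC -mul_bin_diag bin1.
have k5R : 5 <= k%:R :> R by rewrite ler_nat.
have k2 : 0 <= (k%:R - 1) * (k%:R - 2) - k%:R * k%:R / 3 :> R.
  have : 0 <= (k%:R - 5) * k%:R :> R by rewrite mulr_ge0 ?ler0n // subr_ge0.
  lra.
have kb' : 144 <= (1 - eps) * k%:R by move: kb; rewrite ler_pdivrMr ?subr_gt0 // mulrC.
have C3k : 8 * (k%:R * k%:R) <= (1 - eps) * C3.
  have h1 : k%:R * (k%:R * k%:R / 3) <= C3 * 6.
    have -> : C3 * 6 = k%:R * ((k%:R - 1) * (k%:R - 2)).
      by rewrite -C2E mulrA -C3E; ring.
    by rewrite ler_wpM2l ?ler0n // -subr_ge0.
  have h2 : (1 - eps) * (k%:R * (k%:R * k%:R / 3)) <= (1 - eps) * (C3 * 6).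
    by rewrite ler_wpM2l // subr_ge0 ltW.
  have h3 : 144 * (k%:R * k%:R) <= (1 - eps) * k%:R * (k%:R * k%:R).
    by rewrite ler_wpM2r // mulr_ge0.
  lra.
have main : C3 * ((2 + eps) / 2) <= 4 * k%:R * ((k%:R - 1 + eps) / 2)
    + (1 + d) * (C3 * 3) * (eps / 2) + r.+1%:R * (n%:R * (M * T^-1)).
  rewrite -(ler_pM2l P0) C3E; apply: le_trans total _.
  by rewrite le_eqVlt; apply/orP; left; apply/eqP; ring.
(* The gap between [(2 + eps) / 2] and [3 * (eps / 2)] is [1 - eps]; the excess [d] and the
   quadratic term use up at most a quarter of it each. *)
have main2 : (1 - eps) * C3 <= 2 * (r.+1%:R * (n%:R * (M * T^-1))).
  have h1 : k%:R * (k%:R - 1 + eps) <= k%:R * k%:R.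
    by rewrite ler_wpM2l ?ler0n //; lra.
  have h2 : 0 <= C3 * ((1 - eps) * (1 - eps)).
    by rewrite !mulr_ge0 ?subr_ge0 // ltW.
  move: main; rewrite /d; lra.
have X0 : 0 < (1 - eps) * C3 by rewrite mulr_gt0 // subr_gt0.
rewrite -(ler_pM2l X0).
have -> : (1 - eps) * C3 * (2 * M / ((1 - eps) * C3) * n%:R * r.+1%:R) =
    2 * (r.+1%:R * (n%:R * (M * T^-1))) * T.
  by field; rewrite !gt_eqF // subr_gt0.
by rewrite ler_wpM2r // ltW.
Qed.

(** * Upper bound for the matching problem *)

(* The converse half of Yannakakis' theorem: the system is [x >= 0], in one
   variable per term of the factorization. *)
Lemma factorization_lp (R : realType) (P : approx_problem R) (T : finType)
    (c0 : obj P -> R) (al : obj P -> T -> R) (be : sol P -> T -> R) :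
  (forall f, c0 f <= guarantee f) -> (forall f t, 0 <= al f t) ->
  (forall s t, 0 <= be s t) ->
  (forall f s, c0 f = objv f s + \sum_t al f t * be s t) ->
  inhabited (lp_formulation P #|T|).
Proof.
move=> c0g al0 be0 slack; constructor.
pose A : 'M[R]_(#|T|, #|T|) := (- 1%:M).
have AE (x : 'cV[R]_#|T|) i : (A *m x) i 0 = - x i 0.
  by rewrite /A mulNmx mul1mx mxE.
apply: (@LPFormulation R P #|T| #|T| A 0
  (fun s => \col_i be s (enum_val i)) (fun f => - \row_i al f (enum_val i)) c0).
- by move=> s i; rewrite AE !mxE oppr_le0.
- move=> f s; rewrite (slack f s) mulNmx mxE addrC -addrA mxE.
  rewrite -[RHS]addr0; congr (_ + _); apply/eqP; rewrite subr_eq0; apply/eqP.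
  rewrite (reindex (enum_val : 'I_#|T| -> T)) /=; last first.
    by apply: onW_bij; apply: enum_val_bij.
  by apply: eq_bigr => i _; rewrite !mxE.
- move=> f x Ax; apply: le_trans (c0g f); rewrite gerDr mulNmx mxE oppr_le0 mxE.
  apply: sumr_ge0 => i _; rewrite mxE mulr_ge0 //.
  by have := Ax i; rewrite AE mxE oppr_le0.
Qed.

(** * Longest paths in the graph of vertex sets *)

Definition max_avoiding (n : nat) (G : {set {set 'I_n}}) (S : {set 'I_n}) : nat :=
  \max_(M in [set M : {set {set 'I_n}} | is_matching M && [disjoint cover M & S]])
    #|M :&: G|.

Lemma matching0 (n : nat) : is_matching (finset.set0 : {set {set 'I_n}}).
Proof. by rewrite /is_matching sub0set; apply/trivIsetP => A B; rewrite inE. Qed.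

Lemma max_avoiding_witness (n : nat) (G : {set {set 'I_n}}) (S : {set 'I_n}) :
  exists2 M, is_matching M && [disjoint cover M & S] &
    max_avoiding G S = #|M :&: G|.
Proof.
have [|M] := @eq_bigmax_cond _
  (mem [set M : {set {set 'I_n}} | is_matching M && [disjoint cover M & S]])
  (fun M => #|M :&: G|).
  apply/card_gt0P; exists finset.set0.
  by rewrite !inE matching0 /cover big_set0 -setI_eq0 set0I eqxx.
by rewrite inE => hM E; exists M.
Qed.

Lemma matchingU1 (n : nat) (e : {set 'I_n}) (M : {set {set 'I_n}}) :
  #|e| = 2%N -> is_matching M -> [disjoint cover M & e] -> is_matching (e |: M).
Proof.
move=> e2 /andP[/subsetP ME /trivIsetP tM] dMe.
have dis A : A \in M -> [disjoint A & e].
  move=> AM; apply: disjointWl dMe; exact: bigcup_sup.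
apply/andP; split.
  apply/subsetP => A; rewrite in_setU1 => /orP[/eqP->|/ME //].
  by rewrite inE subsetT e2.
apply/trivIsetP => A B; rewrite !in_setU1.
case/orP => [/eqP->|AM]; case/orP => [/eqP->|BM] ne.
- by rewrite eqxx in ne.
- by rewrite disjoint_sym dis.
- exact: dis.
- exact: tM.
Qed.

(** Adding [e] to an optimal matching that avoids [S :|: e] gives a matching that avoids [S]. Hence
    [max_avoiding G] is a feasible potential for longest paths. *)
Lemma max_avoidingU (n : nat) (G : {set {set 'I_n}}) (S e : {set 'I_n}) :
  #|e| = 2%N -> [disjoint e & S] ->
  (max_avoiding G (S :|: e) + (e \in G) <= max_avoiding G S)%N.
Proof.
move=> e2 deS; have [M /andP[mM dM] ->] := max_avoiding_witness G (S :|: e).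
have dMe : [disjoint cover M & e] by apply: disjointWr dM; apply: subsetUr.
have eM : e \notin M.
  apply: contraL dMe => eM; have /card_gt0P[z ze] : (0 < #|e|)%N by rewrite e2.
  by apply/pred0Pn; exists z => /=; rewrite ze andbT; apply/bigcupP; exists e.
have -> : (#|M :&: G| + (e \in G) = #|(e |: M) :&: G|)%N.
  rewrite setIUl cardsU -[LHS]subn0; congr (_ - _)%N.
    rewrite addnC; congr (_ + _)%N.
    have [eG|eG] := boolP (e \in G).
      by have /setIidPl -> : [set e] \subset G; rewrite ?sub1set // cards1.
    suff -> : [set e] :&: G = finset.set0 by rewrite cards0.
    by apply/setP => z; rewrite !inE; case: eqP => // ->; rewrite (negbTE eG).
  apply/esym/eqP; rewrite cards_eq0; apply/eqP/setP => z; rewrite !inE.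
  by case: eqP => // ->; rewrite (negbTE eM) andbF.
apply: (@leq_bigmax_cond _ _ (fun M => #|M :&: G|) (e |: M)).
rewrite inE matchingU1 //= -setI_eq0 /cover bigcup_setU big_set1 setIUl setU_eq0.
rewrite !setI_eq0 deS /=; apply: disjointWr dM; exact: subsetUl.
Qed.

(* Reduced costs in the graph whose vertices are the vertex sets [S], with an
   arc from [S] to [S :|: e] for each edge [e]; the pair [(S, S)] stands for
   stopping at [S]. *)
Definition reduced_cost (n : nat) (G : {set {set 'I_n}})
    (t : {set 'I_n} * {set 'I_n}) : nat :=
  if t.2 == t.1 then max_avoiding G t.1
  else (max_avoiding G t.1 - (max_avoiding G t.2 + (t.2 :\: t.1 \in G)))%N.

(** Adding the edges of [M] one by one is a path of vertex sets along which the potential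
    telescopes. The function [b] marks the arcs of this path and so is the same for all [G]. *)
Lemma matching_path (n : nat) (M : {set {set 'I_n}}) (S : {set 'I_n}) :
  is_matching M -> [disjoint cover M & S] ->
  exists b : {set 'I_n} * {set 'I_n} -> nat, forall G : {set {set 'I_n}},
    max_avoiding G S = (#|M :&: G| + \sum_t reduced_cost G t * b t)%N.
Proof.
have [k] := ubnP #|M|; elim: k M S => // k IH M S Mk mM dMS.
have pick1 (t0 : {set 'I_n} * {set 'I_n}) (F : {set 'I_n} * {set 'I_n} -> nat) :
    (\sum_t F t * (t == t0) = F t0)%N.
  rewrite (bigD1 t0) //= eqxx muln1 big1 ?addn0 // => t /negbTE ->.
  by rewrite muln0.
have [M0|[e eM]] := set_0Vmem M.
  exists (fun t => nat_of_bool (t == (S, S))) => G.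
  by rewrite M0 set0I cards0 pick1 /reduced_cost eqxx.
have /andP[/subsetP ME tM] := mM.
have e2 : #|e| = 2%N by have := ME _ eM; rewrite inE subsetT => /eqP.
have deS : [disjoint e & S] by apply: disjointWl dMS; exact: bigcup_sup.
have mM' : is_matching (M :\ e).
  apply/andP; split; first by apply/subsetP => A /setD1P[_ /ME].
  by apply/trivIsetP => A B /setD1P[_ AM] /setD1P[_ BM]; move/trivIsetP: tM; apply.
have [||b hb] := IH (M :\ e) (S :|: e) _ mM'.
- by have := cardsD1 e M; rewrite eM add1n => E; rewrite E ltnS in Mk.
- rewrite -setI_eq0 setIUr setU_eq0 !setI_eq0; apply/andP; split.
    apply: disjointWl dMS; apply/bigcupsP => A /setD1P[_ AM]; exact: bigcup_sup.
  rewrite disjoint_sym; apply/bigcup_disjointP => A /setD1P[Ae AM].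
  by move/trivIsetP: tM; apply => //; rewrite eq_sym.
exists (fun t => b t + (t == (S, S :|: e)))%N => G.
under eq_bigr => t _ do rewrite mulnDr.
rewrite big_split /= pick1 addnA.
have -> : #|M :&: G| = (#|(M :\ e) :&: G| + (e \in G))%N.
  rewrite (cardsD1 e (M :&: G)) inE eM /= addnC; congr (_ + _)%N.
  by congr #|pred_of_set _|; apply/setP => z; rewrite !inE andbA.
rewrite [X in (X + _)%N]addnAC -hb /reduced_cost /=.
have eS z : z \in e -> z \notin S.
  move=> ze; apply: contraL deS => zS; apply/pred0Pn; exists z => /=; by rewrite ze.
have /negbTE -> : S :|: e != S.
  have /card_gt0P[z ze] : (0 < #|e|)%N by rewrite e2.
  apply: contra (eS _ ze) => /eqP <-; by rewrite inE ze orbT.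
have -> : (S :|: e) :\: S = e.
  rewrite setDUl setDv set0U; apply/setDidPl; exact: deS.
(* The truncated subtraction in [reduced_cost] is exact on this arc. *)
by rewrite subnKC // max_avoidingU.
Qed.

(** [max_avoiding] at the empty set is the exact maximum, which lies below the guarantee. Its slack
    is factored by [matching_path] over the [4 ^ n] pairs of vertex sets. *)
Lemma Match_size_upper (R : realType) (n : nat) (rho : R) : 0 < rho <= 1 ->
  inhabited (lp_formulation (with_factor (Match R n) rho) (4 ^ n)).
Proof.
move=> rho01.
have -> : (4 ^ n = #|{: {set 'I_n} * {set 'I_n}}|)%N.
  by rewrite card_prod -cardsT -powersetT card_powerset cardsT card_ord -expnMn.
have d0 (M : matching n) : [disjoint cover (val M) & (finset.set0 : {set 'I_n})].
  by rewrite -setI_eq0 setI0 eqxx.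
have [b hb] := choice (fun M : matching n => matching_path (valP M) (d0 M)).
apply: (@factorization_lp R (with_factor (Match R n) rho)
  ({set 'I_n} * {set 'I_n})%type (fun G => (max_avoiding (gedges G) finset.set0)%:R)
  (fun G t => (reduced_cost (gedges G) t)%:R) (fun M t => (b M t)%:R)).
- move=> G; have [M /andP[mM _] ->] := max_avoiding_witness (gedges G) finset.set0.
  exact: (Match_guarantees_valid rho01 G (exist _ M mM)).
- by move=> *; rewrite ler0n.
- by move=> *; rewrite ler0n.
move=> G M /=; rewrite (hb M) natrD natr_sum; congr (_ + _).
by apply: eq_bigr => t _; rewrite natrM.
Qed.

(** The formulation is restricted to perfect matchings and to complete graphs on odd sets [U], whose
    maximum is at most [(#|U| - 1) / 2]. Dividing by [1 - eps / n] stays below the guarantee because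
    [#|U| - 1 + eps <= n]. *)
Lemma MatchStar_of_Match (R : realType) (n m : nat) (eps : R) :
  ~~ odd n -> (0 < n)%N -> 0 < eps < 1 ->
  lp_formulation (with_factor (Match R n) (1 - eps / n%:R)) m ->
  lp_formulation (MatchStar n eps) m.
Proof.
move=> en n0 /andP[eps0 eps1] L.
have pm (M : perfect_matching n) : is_matching (val M) by case/andP: (valP M).
pose fM (M : perfect_matching n) : matching n := exist _ (val M) (pm M).
pose fU (U : odd_subset n) : graph_within n := GraphWithin (subxx (edges_in (val U))).
apply: (@LPFormulation R (MatchStar n eps) m (lp_dim L) (lp_mx L) (lp_rhs L)
  (fun M => lp_pt L (fM M)) (fun U => lp_w L (fU U)) (fun U => lp_c L (fU U))).
- by move=> s; apply: lp_pt_feasible.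
- move=> U M; have := lp_obj_exact L (fU U) (fM M).
  by rewrite /lp_obj => -> /=; rewrite setIC.
move=> U x hx; have := @lp_obj_le _ _ _ L (fU U) x hx.
rewrite /lp_obj => /le_trans; apply => /=.
have nR : 0 < n%:R :> R by rewrite ltr0n.
have n1R : 1 <= n%:R :> R by rewrite ler1n.
have en1 : eps / n%:R < 1 by rewrite ltr_pdivrMr // mul1r; lra.
set s := sup _; have hs : s <= (#|val U|%:R - 1) / 2.
  apply: ge_sup.
    by eexists; exists (exist _ finset.set0 (matching0 n)).
  move=> _ [M _ <-] /=; rewrite setIC.
  have := card_matching_edges_in (val U) (valP M).
  rewrite leq_eqVlt => /orP[/eqP h|h].
    by have := valP U; rewrite /= -h oddM andbF.
  by rewrite ler_pdivlMr // lerBrDr -natrM -[1]/(1%:R) -natrD ler_nat addn1.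
have Un : (#|val U| < n)%N.
  rewrite ltn_neqAle -[X in (_ <= X)%N]card_ord max_card andbT.
  by apply: contraNneq en => <-; apply: (valP U).
have U1 : 1 <= #|val U|%:R :> R.
  by rewrite ler1n; case: #|_| (valP U : odd #|val U|).
have UnR : #|val U|%:R <= n%:R - 1 :> R.
  by rewrite lerBrDr -[1]/(1%:R) -natrD ler_nat addn1.
rewrite ler_pdivrMr ?subr_gt0 //; apply: le_trans hs _.
rewrite -(ler_pM2r nR).
have -> : (#|val U|%:R - 1 + eps) / 2 * (1 - eps / n%:R) * n%:R =
   (#|val U|%:R - 1 + eps) / 2 * (n%:R - eps).
  by field; rewrite gt_eqF.
have : 0 <= eps * (n%:R - eps - (#|val U|%:R - 1)) by rewrite mulr_ge0 //; lra.
lra.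
Qed.

(** * Asymptotics *)

(** With [b = a / d.+1], the power [d.+1] of [b * n <= expR (b * n)] has one factor [n] to spare,
    which absorbs [K]. *)
Lemma expR_dominates (R : realType) (a K : R) (d : nat) : 0 < a ->
  exists N : nat, forall n, (N <= n)%N -> K * n%:R ^+ d <= expR (a * n%:R).
Proof.
move=> a0; pose b := a / d.+1%:R; have b0 : 0 < b by rewrite divr_gt0.
exists (Num.bound (K / b ^+ d.+1)) => n hn.
have Kn : K <= n%:R * b ^+ d.+1.
  have [K0|K0] := leP K 0.
    by apply: le_trans K0 _; rewrite mulr_ge0 // exprn_ge0 // ltW.
  rewrite -ler_pdivrMr ?exprn_gt0 //.
  apply: (@le_trans _ _ (Num.bound (K / b ^+ d.+1))%:R).
    by rewrite ltW // archi_boundP // divr_ge0 ?exprn_ge0 // ltW.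
  by rewrite ler_nat.
have -> : a * n%:R = b * n%:R * d.+1%:R by rewrite /b mulrAC divfK // pnatr_eq0.
rewrite expRM_natr; apply: (@le_trans _ _ ((b * n%:R) ^+ d.+1)).
  rewrite exprMn [n%:R ^+ d.+1]exprS mulrA ler_wpM2r ?exprn_ge0 //.
  by rewrite mulrC.
apply: lerXn2r; rewrite ?nnegrE ?expR_ge0 //; first by rewrite mulr_ge0 // ltW.
by have := expR_ge1Dx (b * n%:R); lra.
Qed.

Lemma fc_le (R : realType) (P : approx_problem R) (m : nat) :
  inhabited (lp_formulation P m) -> (fc P <= (m%:R)%:E)%E.
Proof. by move=> Pm; apply: ereal_inf_lbound; exists m. Qed.

Lemma fc_ge (R : realType) (P : approx_problem R) (x : R) :
  (forall m, inhabited (lp_formulation P m) -> x <= m%:R) -> (x%:E <= fc P)%E.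
Proof.
by move=> Px; apply: le_ereal_inf_tmp => _ [m Pm <-]; rewrite lee_fin Px.
Qed.

Lemma powR2_le_expR (R : realType) (x : R) : 0 <= x -> 2 `^ x <= expR x.
Proof.
move=> x0; rewrite /powR pnatr_eq0 /= ler_expR ler_piMr //.
by apply: (@le_ln1Dx R 1); lra.
Qed.

Lemma fc_MatchStar_lower (R : realType) (eps : R) : 0 < eps < 1 ->
  exists (c : R) (N : nat), 0 < c /\ forall n, (N <= n)%N -> ~~ odd n ->
    ((2 `^ (c * n%:R))%:E <= fc (MatchStar n eps))%E.
Proof.
move=> eps01; have [k [c [M [c0 M0 size]]]] := MatchStar_size_lower eps01.
(* The second factor compensates for [j] falling short of [n / 6] by at most [k + 1]. *)
pose M' := M * expR (c * (k%:R + 1)).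
have M'0 : 0 < M' by rewrite mulr_gt0 ?expR_gt0.
have c12 : 0 < c / 12 by rewrite divr_gt0.
have [N hN] := expR_dominates (2 * M') 1 c12.
exists (c / 12), (maxn N (2 * k + 100)); split=> // n.
rewrite geq_max => /andP[Nn kn] en.
(* Both [i] and [j] are about a third of [n./2 - k], with [j <= i], so the minimum [j] is about
   [n / 6]. *)
pose j := ((n./2 - k) %/ 3)%N; pose i := (n./2 - k - 2 * j)%N.
have nE : n = (k * 2 + i * 2 + j * 4)%N.
  have := even_halfK en; rewrite -muln2 /i /j; lia.
have j0 : (0 < j)%N by rewrite /j; have := even_halfK en; lia.
have ij : (j <= i)%N by rewrite /i /j; have := even_halfK en; lia.
have nj : (n <= 6 * (j + k).+1)%N by rewrite /j; have := even_halfK en; lia.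
have njR : n%:R <= 6 * (j%:R + k%:R + 1) :> R by rewrite -natrD natr1 -natrM ler_nat.
apply: fc_ge => r [L]; apply: le_trans (powR2_le_expR _) _.
  by rewrite mulr_ge0 // ltW.
rewrite {1}nE in L; have := size i j r (leq_trans j0 ij) j0 L.
rewrite (minn_idPr ij) -nE => h.
have n0 : 0 < n%:R :> R by rewrite ltr0n; lia.
set T := expR (c / 12 * n%:R).
have T1 : 1 <= T by rewrite -expR0 ler_expR mulr_ge0 // ltW.
have TT : T * T <= M' * n%:R * r.+1%:R.
  apply: (@le_trans _ _ (expR (c * j%:R) * expR (c * (k%:R + 1)))).
    rewrite /T -!expRD ler_expR.
    have -> : c / 12 * n%:R + c / 12 * n%:R = c * (n%:R / 6) by field.
    by rewrite -mulrDr addrA ler_pM2l // ler_pdivrMr // mulrC.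
  have -> : M' * n%:R * r.+1%:R = M * n%:R * r.+1%:R * expR (c * (k%:R + 1)).
    by rewrite /M'; ring.
  by rewrite ler_wpM2r ?expR_ge0.
have h2 := hN n Nn; rewrite expr1 -/T in h2.
(* One factor [T] absorbs [2 * M' * n%:R]; the other leaves [2 * T <= r.+1], hence [T <= r] as
   [1 <= T]. *)
have : M' * n%:R * (2 * T) <= M' * n%:R * r.+1%:R.
  apply: le_trans TT; have -> : M' * n%:R * (2 * T) = 2 * M' * n%:R * T by ring.
  by rewrite ler_wpM2r // expR_ge0.
rewrite ler_pM2l ?(mulr_gt0 M'0 n0) //.
rewrite -natr1; lra.
Qed.

Lemma fc_MatchStar_le_Match (R : realType) (n : nat) (eps : R) :
  ~~ odd n -> (0 < n)%N -> 0 < eps < 1 ->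
  (fc (MatchStar n eps) <= fc_factor (Match R n) (1 - eps / n%:R))%E.
Proof.
move=> en n0 eps01; apply: le_ereal_inf_tmp => _ [m [L] <-]; apply: fc_le.
by constructor; apply: MatchStar_of_Match L.
Qed.

Lemma fc_Match_upper (R : realType) (n : nat) (eps : R) :
  (0 < n)%N -> 0 < eps < 1 ->
  (fc_factor (Match R n) (1 - eps / n%:R) <= (2 `^ (2 * n%:R))%:E)%E.
Proof.
move=> n0 /andP[eps0 eps1].
have n1R : 1 <= n%:R :> R by rewrite ler1n.
have en1 : eps / n%:R < 1 by rewrite ltr_pdivrMr ?ltr0n // mul1r; lra.
have en0 : 0 < eps / n%:R by rewrite divr_gt0 // ltr0n.
have -> : 2 `^ (2 * n%:R) = (4 ^ n)%:R :> R.
  by rewrite -natrM powR_mulrn // natrX -[4%N]/(2 ^ 2)%N natrX exprM.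
apply/fc_le/Match_size_upper; apply/andP; split; lra.
Qed.

(** * Polynomial growth and the final estimates *)

Lemma poly_growth (R : realType) (q : {poly R}) :
  exists (K : R) (d : nat), 0 <= K /\ forall x, 1 <= x -> `|q.[x]| <= K * x ^+ d.
Proof.
elim/poly_ind: q => [|q c [K [d [K0 hK]]]].
  by exists 0, 0%N; split=> // x _; rewrite horner0 normr0 mul0r.
exists (K + `|c|), d.+1; split=> [|x x1]; first by rewrite addr_ge0.
rewrite hornerD hornerMX hornerC mulrDl; apply: le_trans (ler_normD _ _) _.
have x0 : 0 <= x by lra.
apply: lerD; last by rewrite ler_peMr // exprn_ege1.
by rewrite normrM (ger0_norm x0) exprSr mulrA ler_wpM2r // hK.
Qed.

(** The argument [2 * x] is the value of [eps^-1] at [eps = 2^-1 / x]. *)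
Lemma poly2_growth (R : realType) (p : {poly {poly R}}) :
  exists (K : R) (d : nat), 0 <= K /\
    forall x, 1 <= x -> `|p.[x%:P].[2 * x]| <= K * x ^+ d.
Proof.
elim/poly_ind: p => [|p c [K [d [K0 hK]]]].
  by exists 0, 0%N; split=> // x _; rewrite !horner0 normr0 mul0r.
have [K' [d' [K'0 hK']]] := poly_growth c.
exists (K + K' * 2 ^+ d'), (d.+1 + d')%N; split=> [|x x1].
  by rewrite addr_ge0 // mulr_ge0 // exprn_ge0.
have x0 : 0 <= x by lra.
rewrite hornerMXaddC hornerD hornerM hornerC [leRHS]mulrDl.
apply: le_trans (ler_normD _ _) _; apply: lerD.
  rewrite normrM (ger0_norm x0) exprD exprSr.
  apply: (@le_trans _ _ (K * x ^+ d * x)); first by rewrite ler_wpM2r // hK.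
  by rewrite -!mulrA ler_wpM2l // ler_wpM2l ?exprn_ge0 // ler_peMr // exprn_ege1.
have x2 : 1 <= 2 * x by lra.
apply: le_trans (hK' _ x2) _; rewrite exprMn exprD -!mulrA ler_wpM2l //.
by rewrite ler_wpM2l ?exprn_ge0 // ler_peMl ?exprn_ge0 // exprn_ege1.
Qed.

Local Open Scope classical_set_scope.

Theorem theorem3p1 (R : realType) :
  (forall eps : R, 0 < eps < 1 ->
     eq_two_pow_Theta [set n | ~~ odd n] (fun n => fc (MatchStar n eps)) /\
     eq_two_pow_Theta [set n | ~~ odd n]
       (fun n => fc_factor (Match R n) (1 - eps / n%:R))) /\
  ~ admits_FPSRS (Match R).
Proof.
split=> [eps eps01|].
  have [c [N [c0 lower]]] := fc_MatchStar_lower eps01.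
  (* A single chain of inequalities yields both estimates. *)
  have bounds n : (maxn N 1 <= n)%N -> ~~ odd n ->
      ((2 `^ (c * n%:R))%:E <= fc (MatchStar n eps) /\
       fc (MatchStar n eps) <= fc_factor (Match R n) (1 - eps / n%:R) /\
       fc_factor (Match R n) (1 - eps / n%:R) <= (2 `^ (2 * n%:R))%:E)%E.
    rewrite geq_max => /andP[Nn n0] en; split; first exact: lower.
    by split; [apply: fc_MatchStar_le_Match | apply: fc_Match_upper].
  split; exists c, 2; split=> //; exists (maxn N 1) => // n /= Nn en;
    have [h1 [h2 h3]] := bounds n Nn en; split=> //.
  - exact: le_trans h2 h3.
  - exact: le_trans h1 h2.
(* At [eps = 2^-1 / n] the scheme would give polynomial size for the very factor to which the
   exponential lower bound with [2^-1] applies. *)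
move=> [p hp]; have half01 : 0 < (2^-1 : R) < 1 by apply/andP; split; lra.
have [c [N [c0 lower]]] := fc_MatchStar_lower half01.
have [K [d [K0 hK]]] := poly2_growth p.
have cl : 0 < c * ln 2 by rewrite mulr_gt0 // ln_gt0 //; lra.
(* Taking [K + 1] instead of [K] makes the final comparison strict. *)
have [N' hN'] := expR_dominates (K + 1) d cl.
pose n := (maxn 1 (maxn N N')).*2.
have n0 : (0 < n)%N by rewrite double_gt0 leq_max.
have en : ~~ odd n by rewrite odd_double.
have nN : (maxn 1 (maxn N N') <= n)%N by rewrite /n -addnn leq_addr.
have Nn : (N <= n)%N by apply: leq_trans nN; rewrite !leq_max leqnn orbT.
have N'n : (N' <= n)%N by apply: leq_trans nN; rewrite !leq_max leqnn !orbT.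
have n1R : 1 <= n%:R :> R by rewrite ler1n.
have nR : 0 < n%:R :> R by rewrite ltr0n.
have e01 : 0 < (2^-1 / n%:R : R) < 1.
  by rewrite divr_gt0 //= ltr_pdivrMr // mul1r; lra.
have := le_trans (lower n Nn en)
  (le_trans (fc_MatchStar_le_Match en n0 half01) (hp _ n e01)).
have -> : (2^-1 / n%:R)^-1 = 2 * n%:R :> R by rewrite invfM !invrK.
rewrite lee_fin => /le_trans /(_ (ler_norm _)) /le_trans /(_ (hK _ n1R)).
rewrite /powR pnatr_eq0 /= -mulrA [n%:R * ln 2]mulrC mulrA => /(le_trans (hN' n N'n)).
by rewrite ler_pM2r ?exprn_gt0 // gerDl ler10.
Qed.
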